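(* Let $X,Y$ be compact subsets of $\mathbb{R}$ and let $E$ and $F$ be infinite-dimensional Banach spaces over $\mathbb{K}$. Let $T:AC(X,E)\rightarrow AC(Y,F)$ be a biseparating map. Then there exist a homeomorphism $h:Y\rightarrow X$ (from $Y$ onto $X$) and, for each $y\in Y$, a linear and bijective map $J_{y}:E\rightarrow F$, such that $$Tf(y)=J_{y}(f(h(y)))$$ for every $f\in AC(X,E)$ and $y\in Y$. Also, if $Y$ has no isolated points, then $T$ is continuous (with respect to the norms $\|\cdot\|_{AC}$).
   Context: $\mathbb{K}$ denotes $\mathbb{R}$ or $\mathbb{C}$ (the same field for $E$ and $F$). For a compact set $X\subset\mathbb{R}$ and a Banach space $E$ over $\mathbb{K}$, a function $f:X\to E$ is absolutely continuous if for every $\varepsilon>0$ there is $\delta>0$ such that $\sum_{i=1}^{m}\|f(b_i)-f(a_i)\|<\varepsilon$ for each finite family of non-overlapping open intervals $\{(a_i,b_i)\}_{i=1}^{m}$ whose endpoints belong to $X$ with $\sum_{i=1}^{m}(b_i-a_i)<\delta$. $AC(X,E)$ is the space of all such functions, with norm $\|f\|_{AC}:=\|f\|_\infty+V(f;X)$, where $\|\cdot\|_\infty$ is the supremum norm and $V(f;X):=\sup\sum_{i=1}^{m}\|f(x_i)-f(x_{i-1})\|$, the supremum being over all finite families $x_0<x_1<\dots<x_m$ of points of $X$. The cozero set of $f$ is $c(f):=\{x: f(x)\neq 0\}$. A map $T:AC(X,E)\to AC(Y,F)$ is separating if it is linear and $c(Tf)\cap c(Tg)=\emptyset$ whenever $f,g\in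 AC(X,E)$ satisfy $c(f)\cap c(g)=\emptyset$. $T$ is biseparating if it is bijective and both $T$ and $T^{-1}$ are separating. *)

(* Defs.v *)
From HB Require Import structures.
From mathcomp Require Import all_boot all_order all_algebra.
From mathcomp Require Import all_classical all_reals all_analysis.
From mathcomp Require Import complex.

Set Implicit Arguments.
Unset Strict Implicit.
Unset Printing Implicit Defensive.

Import Order.TTheory GRing.Theory Num.Theory.
Import numFieldNormedType.Exports.

Local Open Scope classical_set_scope.
Local Open Scope ring_scope.

Variant scalar_kind := RealScalars | ComplexScalars.

Definition scalars (R : realType) (k : scalar_kind) : numFieldType :=
  match k with
  | RealScalars => R
  | ComplexScalars => R[i]
  end.

Definition to_real (R : realType) (k : scalar_kind) : scalars R k -> R :=
  match k return scalars R k -> R with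
  | RealScalars => fun x => x
  | ComplexScalars => fun x => complex.Re x
  end.

(* The norm `|v| of a normed module over scalars R k takes values in
   scalars R k (with zero imaginary part over R[i]); this is the same
   number seen in R. *)
Definition rnorm (R : realType) (k : scalar_kind)
  (E : normedModType (scalars R k)) (v : E) : R := to_real `|v|.

Definition infinite_dimensional (K : fieldType) (E : lmodType K) : Prop :=
  ~ exists (n : nat) (e : 'I_n -> E),
      forall v, exists c : 'I_n -> K, v = \sum_(i < n) c i *: e i.

Definition homeomorphism (S T : topologicalType) (h : S -> T) : Prop :=
  exists g : T -> S, [/\ cancel h g, cancel g h, continuous h & continuous g].

Section absolutely_continuous.
Context (R : realType) (k : scalar_kind).
Implicit Types (X : set R) (E : normedModType (scalars R k)).

Definition abs_continuous X E (f : X -> E) : Prop :=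
  forall e : R, 0 < e -> exists2 d : R, 0 < d &
    forall (m : nat) (a b : 'I_m -> X),
      (forall i, set_val (a i) < set_val (b i)) ->
      trivIset setT (fun i => `]set_val (a i), set_val (b i)[%classic) ->
      \sum_(i < m) (set_val (b i) - set_val (a i)) < d ->
      \sum_(i < m) rnorm (f (b i) - f (a i)) < e.

(* Supremum in [0, +oo] of a set of nonnegative reals; adding 0 only matters
   for the empty set, whose supremum is then 0 instead of -oo. *)
Definition nneg_sup (A : set R) : \bar R :=
  ereal_sup (0%E |` [set r%:E | r in A]).

Definition sup_norm X E (f : X -> E) : \bar R :=
  nneg_sup (range (fun x => rnorm (f x))).

Definition variation_on X E (f : X -> E) : \bar R :=
  nneg_sup [set v | exists (m : nat) (x : 'I_m.+1 -> X),
    (forall i j : 'I_m.+1, (i < j)%N -> set_val (x i) < set_val (x j)) /\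
    v = \sum_(i < m) rnorm (f (x (lift ord0 i))
                            - f (x (widen_ord (leqnSn m) i)))].

Definition ac_pred X E : {pred X -> E} := [pred f | `[< abs_continuous f >]].

End absolutely_continuous.

Record ACspace (R : realType) (k : scalar_kind) (X : set R)
    (E : normedModType (scalars R k)) := MkACspace {
  AC_fun :> X -> E ;
  AC_funP : AC_fun \in @ac_pred R k X E }.

Section AC_lmodule.
Context (R : realType) (k : scalar_kind) (X : set R)
  (E : normedModType (scalars R k)).

HB.instance Definition _ := [isSub for @AC_fun R k X E].
HB.instance Definition _ := [Choice of ACspace X E by <:].

Lemma rnorm_lin (c : scalars R k) : exists2 C : R, 0 < C &
  forall u v : E, rnorm (c *: u + v) <= C * rnorm u + rnorm v.
Proof.
rewrite /rnorm; move: E c; case: k => E' c /=.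
  exists (`|c| + 1 : R); first by rewrite ltr_wpDl.
  move=> u v; apply: (le_trans (ler_normD _ _)).
  by rewrite normrZ lerD2r ler_wpM2r// lerDl.
exists (complex.Re `|c| + 1).
  have : 0 <= `|c| by [].
  by rewrite lecE => /andP[_ c0]; rewrite ltr_wpDl.
move=> u v; have := ler_normD (c *: u) v; rewrite normrZ lecE => /andP[_].
move=> /le_trans; apply.
have : 0 <= `|u| by []. have : 0 <= `|c| by [].
case: `|c| => cr ci; case: `|u| => ur ui; case: `|v| => vr vi.
rewrite !lecE /= => /andP[/eqP-> c0] /andP[/eqP-> u0].
by rewrite mul0r subr0 lerD2r ler_wpM2r// lerDl.
Qed.

Lemma ac_submod_closed : submod_closed (@ac_pred R k X E).
Proof.
split.
  apply/asboolP => e e0; exists 1 => // m a b _ _ _.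
  rewrite big1// => i _; rewrite /GRing.zero /= subrr /rnorm normr0.
  by case: k.
move=> c f g /asboolP fac /asboolP gac; apply/asboolP => e e0.
have [C C0 leC] := rnorm_lin c.
have e2 : 0 < e / 2 by rewrite divr_gt0.
have [df df0 Hf] := fac (e / 2 / C) (divr_gt0 e2 C0).
have [dg dg0 Hg] := gac _ e2.
exists (Order.min df dg); first by rewrite lt_min df0.
move=> m a b ab tab; rewrite lt_min => /andP[/Hf-/(_ ab tab) Sf].
move=> /Hg-/(_ ab tab) Sg; rewrite [e]splitr.
have {}Sf : C * \sum_(i < m) rnorm (f (b i) - f (a i)) < e / 2.
  by rewrite mulrC -ltr_pdivlMr.
apply: le_lt_trans (ltrD Sf Sg); rewrite mulr_sumr -big_split /=.
apply: ler_sum => i _; apply: le_trans (leC _ _).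
rewrite le_eqVlt; apply/orP; left; apply/eqP; congr rnorm.
by rewrite [X in X - _]/= [X in _ - X]/= scalerBr opprD addrACA.
Qed.

HB.instance Definition _ :=
  GRing.isSubmodClosed.Build _ _ (@ac_pred R k X E) ac_submod_closed.
HB.instance Definition _ := [SubChoice_isSubLmodule of ACspace X E by <:].

(* Finite when X is compact. *)
Definition ac_norm (f : ACspace X E) : \bar R := (sup_norm f + variation_on f)%E.

Definition cozero (f : ACspace X E) : set X := [set x | f x != 0].

End AC_lmodule.

Section separating_maps.
Context (R : realType) (k : scalar_kind) (X Y : set R)
  (E F : normedModType (scalars R k)).

Definition separating (T : ACspace X E -> ACspace Y F) : Prop :=
  linear T /\
  forall f g : ACspace X E, cozero f `&` cozero g = set0 ->
    cozero (T f) `&` cozero (T g) = set0.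

Definition ac_norm_continuous (T : ACspace X E -> ACspace Y F) : Prop :=
  forall (f : ACspace X E) (e : R), 0 < e -> exists2 d : R, 0 < d &
    forall g : ACspace X E, (ac_norm (g - f)%R < d%:E)%E ->
      (ac_norm (T g - T f)%R < e%:E)%E.

End separating_maps.

Definition biseparating (R : realType) (k : scalar_kind) (X Y : set R)
    (E F : normedModType (scalars R k)) (T : ACspace X E -> ACspace Y F) : Prop :=
  exists S : ACspace Y F -> ACspace X E,
    [/\ cancel T S, cancel S T, separating T & separating S].

(* Main.v *)
(* Every y in Y has a support point h y in X: near h y there live functions f
   with T f y <> 0, whereas T f y = 0 as soon as f vanishes near h y. The map h
   is a homeomorphism whose inverse is the support map of the inverse of T. If f
   only vanishes at x = h y, write f = f1 + f2 where each fi = ri(|f|) f vanishes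
   on open sets accumulating at x (the functions v |-> ri(|v|) v are Lipschitz
   although ri oscillates near 0, so that fi stays absolutely continuous);
   continuity of T fi then gives T fi y = 0. Hence T f y = J y (f (h y)) with J y
   linear. For continuity of T, two gliding hump arguments bound first the maps
   J y uniformly outside a finite set, which is enough when Y has no isolated
   points, and then the variation of T f. *)
Require Import Defs.
From HB Require Import structures.
From mathcomp Require Import all_boot all_order all_algebra.
From mathcomp Require Import all_classical all_reals all_analysis.
From mathcomp Require Import complex.
From mathcomp Require Import lra ring.

Set Implicit Arguments.
Unset Strict Implicit.
Unset Printing Implicit Defensive.

Import Order.TTheory GRing.Theory Num.Theory.
Import numFieldNormedType.Exports.

Local Open Scope classical_set_scope.
Local Open Scope ring_scope.

(** The obstacle is that no continuity of [T] is available at the outset: a function vanishing at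
    [h y] cannot be replaced by approximations vanishing near [h y], so an exact two-term
    decomposition is needed. For the same reason nothing bounds a single fibre map a priori. The
    gliding hump therefore uses seminorms that are controlled only on a region given by a weight.
    For the value of [T f] at [y] the weight is 0 at [h y], so that later humps leave that value
    exactly unchanged. For the variation of [T f] along a fixed finite chain the weight is a
    positive constant, which is possible because the supremum bound is already known. The limit
    function always contradicts the boundedness, or the bounded variation, of its image on the
    compact set [Y]. *)

Definition of_real (R : realType) (k : scalar_kind) : R -> scalars R k :=
  match k return R -> scalars R k with
  | RealScalars => fun x => x
  | ComplexScalars => fun x => x%:C%C
  end.
Arguments of_real {R} k.

(** * Real-valued norms over real or complex scalars *)

Section real_norm.
Context (R : realType) (k : scalar_kind).
Implicit Types (E : normedModType (scalars R k)).

Lemma of_realM : {morph @of_real R k : a b / a * b}.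
Proof. by case: k => a b //=; rewrite rmorphM. Qed.

Lemma of_realB : {morph @of_real R k : a b / a - b}.
Proof. by case: k => a b //=; rewrite rmorphB. Qed.

Lemma of_real1 : of_real k (1 : R) = 1.
Proof. by case: k => //=; rewrite rmorph1. Qed.

Lemma of_real0 : of_real k (0 : R) = 0.
Proof. by case: k => //=; rewrite rmorph0. Qed.

Lemma to_realK : cancel (@of_real R k) (@to_real R k).
Proof. by case: k. Qed.

Lemma of_realK_ge0 (c : scalars R k) : 0 <= c -> of_real k (to_real c) = c.
Proof.
by case: k c => //= -[a b]; rewrite lecE/= => /andP[/eqP-> _].
Qed.

Lemma ltr_of_real (a b : R) : (of_real k a < of_real k b) = (a < b).
Proof. by case: k => //=; rewrite ltcR. Qed.

Lemma of_real_gt0 (a : R) : (0 < of_real k a) = (0 < a).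
Proof. by rewrite -ltr_of_real of_real0. Qed.

Lemma norm_of_real (a : R) : `|of_real k a| = of_real k `|a|.
Proof. by case: k => //=; rewrite normc_def/= expr0n/= addr0 sqrtr_sqr. Qed.

Lemma normrE E (v : E) : `|v| = of_real k (rnorm v).
Proof. by rewrite /rnorm of_realK_ge0. Qed.

Lemma rnorm_ge0 E (v : E) : 0 <= rnorm v.
Proof.
have : 0 <= `|v| by []; rewrite normrE le_eqVlt => /orP[/eqP h|].
  by rewrite -[rnorm v](@to_realK) -h; case: {+}k.
by rewrite of_real_gt0 => /ltW.
Qed.

Lemma rnormD E (u v : E) : rnorm (u + v) <= rnorm u + rnorm v.
Proof.
have := ler_normD u v; rewrite !normrE; rewrite /rnorm.
by case: {+}k E u v => //= E u v; rewrite -rmorphD/= lecR.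
Qed.

Lemma rnorm0 E : rnorm (0 : E) = 0.
Proof. by rewrite /rnorm normr0; case: {+}k. Qed.

Lemma rnorm_eq0 E (v : E) : rnorm v = 0 -> v = 0.
Proof. by move=> h; apply/normr0_eq0; rewrite normrE h of_real0. Qed.

Lemma rnorm_gt0 E (v : E) : (0 < rnorm v) = (v != 0).
Proof.
rewrite lt_def rnorm_ge0 andbT; congr negb; apply/eqP/eqP => [|->].
  exact: rnorm_eq0.
exact: rnorm0.
Qed.

Lemma rnormN E (v : E) : rnorm (- v) = rnorm v.
Proof. by rewrite /rnorm normrN. Qed.

Lemma rnormBC E (u v : E) : rnorm (u - v) = rnorm (v - u).
Proof. by rewrite -rnormN opprB. Qed.

Lemma rnormZ E (a : R) (v : E) : rnorm (of_real k a *: v) = `|a| * rnorm v.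
Proof.
by rewrite /rnorm normrZ norm_of_real [`|v|]normrE -of_realM !to_realK.
Qed.

Lemma rnorm_triangle E (v u w : E) : rnorm (u - w) <= rnorm (u - v) + rnorm (v - w).
Proof. by rewrite -{1}(subrK v u) -addrA rnormD. Qed.

Lemma rnorm_leD E (u v : E) : rnorm u <= rnorm (u - v) + rnorm v.
Proof. by rewrite -{1}[u](subrK v) rnormD. Qed.

Lemma rnorm_dist E (u v : E) : `|rnorm u - rnorm v| <= rnorm (u - v).
Proof.
rewrite ler_norml; apply/andP; split.
  by rewrite lerNl opprB lerBlDr rnormBC rnorm_leD.
by rewrite lerBlDr rnorm_leD.
Qed.

Lemma rnorm_sum E (I : Type) (r : seq I) (P : pred I) (F : I -> E) :
  rnorm (\sum_(i <- r | P i) F i) <= \sum_(i <- r | P i) rnorm (F i).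
Proof.
elim/big_ind2: _ => [|u a v b ua vb|//]; first by rewrite rnorm0.
by apply: le_trans (rnormD _ _) _; rewrite lerD.
Qed.

End real_norm.

(** * Supremum norm, and variation along finite chains *)

Section sup_norm_and_variation.
Context (R : realType) (k : scalar_kind).
Implicit Types (X : set R) (E : normedModType (scalars R k)).

Lemma nneg_sup_le (A : set R) (C : R) : 0 <= C ->
  (nneg_sup A <= C%:E)%E <-> forall r, A r -> r <= C.
Proof.
move=> C0; split=> [h r Ar|h].
  by rewrite -lee_fin; apply: le_trans h; apply: ereal_sup_ubound; right; exists r.
apply: ge_ereal_sup => _ [->|[r Ar <-]]; rewrite lee_fin//.
exact: h.
Qed.

Lemma nneg_sup_ge0 (A : set R) : (0 <= nneg_sup A)%E.
Proof. by apply: ereal_sup_ubound; left. Qed.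

Lemma sup_norm_le X E (f : X -> E) (C : R) : 0 <= C ->
  (sup_norm f <= C%:E)%E <-> forall x, rnorm (f x) <= C.
Proof.
move=> C0; split=> [/nneg_sup_le h x|h]; first by apply: h => //; exists x.
by apply/nneg_sup_le => // _ [x _ <-].
Qed.

Definition increasing_from X (t : X) (s : seq X) : bool :=
  path (fun a b : X => set_val a < set_val b) t s.

(** Splitting off the first point of a chain allows induction and concatenation; [variation_on_le]
    links this form to the ordinal-indexed sums of [variation_on]. *)
Fixpoint seq_variation X E (f : X -> E) (t : X) (s : seq X) : R :=
  if s is z :: s' then rnorm (f z - f t) + seq_variation f z s' else 0.

Lemma seq_variationE X E (f : X -> E) t s : seq_variation f t s =
  \sum_(i < size s) rnorm (f (nth t (t :: s) i.+1) - f (nth t (t :: s) i)).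
Proof.
elim: s t => [|z s ih] t /=; first by rewrite big_ord0.
rewrite big_ord_recl/= ih; congr (_ + _); apply: eq_bigr => i _ /=.
have hi := ltn_ord i.
by congr (rnorm (f _ - f _)); apply: set_nth_default => //=; rewrite ltnS ltnW.
Qed.

Lemma increasing_from_nth X (t : X) s i j : increasing_from t s ->
  (i < j <= size s)%N -> set_val (nth t (t :: s) i) < set_val (nth t (t :: s) j).
Proof.
move=> ts /andP[ij js].
apply: (@sorted_ltn_nth _ (fun a b : X => set_val a < set_val b)) => //.
- by move=> a b c; apply: lt_trans.
- by rewrite inE/= ltnS (leq_trans (ltnW ij)).
Qed.

Lemma variation_on_le X E (f : X -> E) (C : R) : 0 <= C ->
  (variation_on f <= C%:E)%E <->
  forall t s, increasing_from t s -> seq_variation f t s <= C.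
Proof.
move=> C0; split=> [/nneg_sup_le h t s ts|h].
  apply: h => //; exists (size s), (fun i => nth t (t :: s) i); split.
    by move=> i j ij; apply: increasing_from_nth => //; rewrite ij -ltnS ltn_ord.
  by rewrite seq_variationE; apply: eq_bigr => i _.
apply/nneg_sup_le => // _ [m [x [xlt ->]]].
pose s := [seq x i | i <- enum 'I_m.+1].
have ss : size s = m.+1 by rewrite size_map size_enum_ord.
have snth z (i : 'I_m.+1) : nth z s i = x i.
  by rewrite (nth_map i) ?size_enum_ord// nth_ord_enum.
case E0 : s ss => [//|t s'] /= [ss'].
suff ts' : increasing_from t s'.
  apply: le_trans (h _ _ ts'); rewrite seq_variationE ss'.
  apply: ler_sum => i _; rewrite -E0.
  have -> : i.+1 = lift ord0 i :> nat by [].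
  by rewrite snth (snth _ (widen_ord (leqnSn m) i)).
have : sorted (fun a b : X => set_val a < set_val b) s.
  apply/(sortedP t) => i; rewrite E0 [size _]/= ss' ltnS => im.
  have im1 : (i < m.+1)%N by rewrite ltnS ltnW.
  have im2 : (i.+1 < m.+1)%N by rewrite ltnS.
  rewrite -E0 (snth t (Ordinal im1)) (snth t (Ordinal im2)).
  exact: xlt.
by rewrite E0.
Qed.

Lemma variation_on_ge0 X E (f : X -> E) : (0 <= variation_on f)%E.
Proof. exact: nneg_sup_ge0. Qed.

Lemma sup_norm_ge0 X E (f : X -> E) : (0 <= sup_norm f)%E.
Proof. exact: nneg_sup_ge0. Qed.

(* If x is an interval of the family with the smallest left endpoint then all the
   others lie to its right, so its endpoints can be prepended to the sequence. *)
Lemma disjoint_intervals_seq X E (f : X -> E) (m : nat) (a b : 'I_m -> X)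
    (A : {set 'I_m}) (t : X) :
  (forall i, set_val (a i) < set_val (b i)) ->
  trivIset setT (fun i => `]set_val (a i), set_val (b i)[%classic) ->
  (forall i, i \in A -> set_val t <= set_val (a i)) ->
  exists2 s, increasing_from t s &
    \sum_(i in A) rnorm (f (b i) - f (a i)) <= seq_variation f t s.
Proof.
move=> ab tab; have [n] := ubnP #|A|; elim: n => // n ih in A t *.
move=> An tA; have [->|/set0Pn[j jA]] := eqVneq A finset.set0.
  by exists [::] => //; rewrite big_set0.
case: (@Order.TotalTheory.arg_minP _ R _ j (fun i => i \in A)
  (fun i => set_val (a i)) jA) => i0 i0A i0min.
have [|j'|s ts le_s] := ih (A :\ i0)%SET (b i0).
- by move: An; rewrite (cardsD1 i0) i0A.
- rewrite !inE => /andP[ji0 j'A]; rewrite leNgt; apply/negP => aj.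
  have := i0min _ j'A => le_a.
  pose c := Order.min (set_val (b i0)) (set_val (b j')).
  have ltc : set_val (a j') < c by rewrite lt_min aj ab.
  have cb : c <= set_val (b i0) by rewrite ge_min lexx.
  have cb' : c <= set_val (b j') by rewrite ge_min lexx orbT.
  move/eqP : ji0; apply; apply: tab => //; exists ((set_val (a j') + c) / 2).
  by split; rewrite /= in_itv/=; apply/andP; split; lra.
have sumE : \sum_(i in A) rnorm (f (b i) - f (a i)) <=
    rnorm (f (b i0) - f (a i0)) + seq_variation f (b i0) s.
  by rewrite (big_setD1 _ i0A)/= lerD2l.
have := tA _ i0A; rewrite le_eqVlt => /orP[/eqP ta|ta].
  have -> : t = a i0 by move: ta; rewrite set_valE => /val_inj.
  by exists (b i0 :: s) => //; rewrite /increasing_from/= ab.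
exists [:: a i0, b i0 & s]; first by rewrite /increasing_from/= ta ab.
by rewrite /=; apply: (le_trans sumE); rewrite lerDr rnorm_ge0.
Qed.

End sup_norm_and_variation.

(** * Piecewise linear cut-off functions *)

Section clamp.
Context (R : realType).

Definition clamp (z : R) : R := if z <= 0 then 0 else if 1 <= z then 1 else z.

Lemma clamp_ge0 z : 0 <= clamp z.
Proof. by rewrite /clamp; case: (leP z 0) => ?; case: (leP 1 z) => ?; lra. Qed.

Lemma clamp_le1 z : clamp z <= 1.
Proof. by rewrite /clamp; case: (leP z 0) => ?; case: (leP 1 z) => ?; lra. Qed.

Lemma clamp_homo y z : y <= z -> clamp y <= clamp z.
Proof.
by rewrite /clamp => ?; case: (leP y 0) => ?; case: (leP z 0) => ?;
  case: (leP 1 y) => ?; case: (leP 1 z) => ?; lra.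
Qed.

Lemma clamp_lip y z : `|clamp y - clamp z| <= `|y - z|.
Proof.
wlog yz : y z / y <= z => [h|].
  by case/orP: (le_total y z) => /h//; rewrite distrC [`|y - z|]distrC.
rewrite distrC [`|y - z|]distrC !ger0_norm ?subr_ge0 ?clamp_homo//.
by rewrite /clamp; case: (leP y 0) => ?; case: (leP z 0) => ?;
  case: (leP 1 y) => ?; case: (leP 1 z) => ?; lra.
Qed.

Lemma clamp_le0 z : z <= 0 -> clamp z = 0.
Proof. by rewrite /clamp => ->. Qed.

Lemma clamp_ge1 z : 1 <= z -> clamp z = 1.
Proof. by rewrite /clamp => z1; case: leP => [?|]; [lra|rewrite z1]. Qed.

(* A tent of height 1 written as a difference of two nondecreasing functions, so
   that its total variation is visibly at most 2. *)
Definition hat (c r t : R) : R := clamp ((t - c) / r + 1) - clamp ((t - c) / r).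

Lemma hat_center c r : hat c r c = 1.
Proof. by rewrite /hat subrr mul0r add0r clamp_ge1// clamp_le0// subr0. Qed.

Lemma hat_norm_le1 c r t : `|hat c r t| <= 1.
Proof.
have := clamp_le1 ((t - c) / r + 1); have := clamp_ge0 ((t - c) / r).
by rewrite ger0_norm ?subr_ge0 ?clamp_homo ?lerDl// /hat; lra.
Qed.

Lemma hat_out c r t : 0 < r -> r <= `|t - c| -> hat c r t = 0.
Proof.
move=> r0; rewrite ler_normr /hat => /orP[] h.
  have h1 : 1 <= (t - c) / r by rewrite ler_pdivlMr// mul1r.
  rewrite (clamp_ge1 h1) clamp_ge1 ?subrr//; lra.
have h1 : (t - c) / r <= -1 by rewrite ler_pdivrMr//; lra.
rewrite [X in X - _]clamp_le0 ?clamp_le0 ?subrr//; lra.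
Qed.

Lemma hat_lip c r s t : 0 < r -> `|hat c r s - hat c r t| <= 2 / r * `|s - t|.
Proof.
move=> r0; have := clamp_lip ((s - c) / r + 1) ((t - c) / r + 1).
have := clamp_lip ((s - c) / r) ((t - c) / r).
have -> : (s - c) / r - (t - c) / r = (s - t) / r by ring.
have -> : (s - c) / r + 1 - ((t - c) / r + 1) = (s - t) / r by ring.
have -> : 2 / r * `|s - t| = `|(s - t) / r| + `|(s - t) / r|.
  have hr : `|r^-1| = r^-1 by rewrite gtr0_norm ?invr_gt0.
  by rewrite normrM hr; ring.
move=> h1 h2; apply: le_trans (lerD h2 h1); rewrite /hat.
set p := clamp _; set q := clamp _; set p' := clamp _; set q' := clamp _.
have -> : p - q - (p' - q') = (p - p') - (q - q') by ring.
exact: ler_normB.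
Qed.

End clamp.

(** * Construction of absolutely continuous functions *)

Section abs_continuous_functions.
Context (R : realType) (k : scalar_kind) (X : set R).
Implicit Types (E : normedModType (scalars R k)).

Lemma AC_abs_continuous E (f : ACspace X E) : abs_continuous f.
Proof. by apply/asboolP; have := AC_funP f. Qed.

Lemma AC_exists E (f : X -> E) : abs_continuous f ->
  exists g : ACspace X E, forall x, g x = f x.
Proof. by move=> /asboolP fac; exists (@MkACspace _ _ _ _ f fac). Qed.

Lemma AC_ext E (f g : ACspace X E) : (forall x, f x = g x) -> f = g.
Proof. by move=> fg; apply/val_inj/funext. Qed.

Lemma AC_addE E (f g : ACspace X E) x : (f + g) x = f x + g x.
Proof. by []. Qed.

Lemma AC_oppE E (f : ACspace X E) x : (- f) x = - f x.
Proof. by []. Qed.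

Lemma AC_subE E (f g : ACspace X E) x : (f - g) x = f x - g x.
Proof. by []. Qed.

Lemma AC_scaleE E c (f : ACspace X E) x : (c *: f) x = c *: f x.
Proof. by []. Qed.

Lemma AC_zeroE E x : (0 : ACspace X E) x = 0.
Proof. by []. Qed.

Lemma AC_sumE E (u : nat -> ACspace X E) n x :
  (\sum_(0 <= i < n) u i) x = \sum_(0 <= i < n) u i x.
Proof.
elim: n => [|n ih]; first by rewrite !big_nil.
by rewrite !big_nat_recr//= -ih.
Qed.

(** Over a family of small total length the [g] terms have a small sum by absolute continuity, and
    the distance terms add up to that length. Compositions, constants and products all reduce to
    this criterion. *)
Lemma abs_continuous_dominated E (E' : normedModType (scalars R k)) (f : X -> E)
    (g : ACspace X E') (C D : R) : 0 < C -> 0 < D ->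
  (forall x y, rnorm (f x - f y) <=
    C * rnorm (g x - g y) + D * `|set_val x - set_val y|) ->
  abs_continuous f.
Proof.
move=> C0 D0 fg e e0.
have e2 : 0 < e / 2 by rewrite divr_gt0.
have [d d0 Hd] := AC_abs_continuous g (divr_gt0 e2 C0).
exists (Order.min d (e / 2 / D)); first by rewrite lt_min d0/= divr_gt0.
move=> m a b ab tab; rewrite lt_min => /andP[/Hd-/(_ ab tab) Sg Sd].
rewrite ltr_pdivlMr// mulrC mulr_sumr in Sd.
rewrite ltr_pdivlMr// mulrC mulr_sumr in Sg.
rewrite [e]splitr; apply: le_lt_trans (ltrD Sg Sd).
rewrite -big_split/=; apply: ler_sum => i _; apply: le_trans (fg _ _) _.
by rewrite gtr0_norm// subr_gt0.
Qed.

Lemma AC_comp_lip E (f : ACspace X E) (th : E -> E) (L : R) : 0 < L ->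
  (forall u v, rnorm (th u - th v) <= L * rnorm (u - v)) ->
  exists g : ACspace X E, forall x, g x = th (f x).
Proof.
move=> L0 thL; apply: AC_exists; apply: (@abs_continuous_dominated _ _ _ f L 1) => // x y.
by apply: le_trans (thL _ _) _; rewrite lerDl mul1r.
Qed.

Lemma AC_const E (v : E) : exists g : ACspace X E, forall x, g x = v.
Proof.
apply: AC_exists; apply: (@abs_continuous_dominated _ _ _ (0 : ACspace X E) 1 1) => // x y.
by rewrite subrr rnorm0 addr_ge0// mulr_ge0// rnorm_ge0.
Qed.

Lemma AC_mul E (f : ACspace X E) (phi : R -> R) (L M : R) :
  (forall x, rnorm (f x) <= M) ->
  (forall s, `|phi s| <= 1) -> (forall s t, `|phi s - phi t| <= L * `|s - t|) ->
  exists g : ACspace X E, forall x, g x = of_real k (phi (set_val x)) *: f x.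
Proof.
move=> fM phi1 phiL; apply: AC_exists.
(* The second constant comes from the product rule for increments; the absolute values and the [+ 1]
   make it positive. *)
apply: (@abs_continuous_dominated _ _ _ f 1 (`|L| * `|M| + 1)) => // x y.
have -> : of_real k (phi (set_val x)) *: f x - of_real k (phi (set_val y)) *: f y =
    of_real k (phi (set_val x)) *: (f x - f y) +
    of_real k (phi (set_val x) - phi (set_val y)) *: f y.
  by rewrite of_realB scalerBr scalerBl addrA subrK.
apply: le_trans (rnormD _ _) _; rewrite !rnormZ; apply: lerD.
  by rewrite ler_wpM2r// rnorm_ge0.
rewrite mulrDl mul1r -[leLHS]addr0; apply: lerD => //.
rewrite mulrAC; apply: ler_pM => //; first exact: rnorm_ge0.
  by apply: le_trans (phiL _ _) _; rewrite ler_wpM2r// ler_norm.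
exact: le_trans (fM _) (ler_norm _).
Qed.

(** Both bounds are independent of [r], so a hump can be made as narrow as desired at no cost in the
    norm. *)
Lemma AC_bump E (x : X) (r : R) (v : E) : 0 < r ->
  exists u : ACspace X E, [/\ u x = v,
    forall z, r <= `|set_val z - set_val x| -> u z = 0,
    forall z, rnorm (u z) <= rnorm v &
    forall t s, increasing_from t s -> seq_variation u t s <= 2 * rnorm v].
Proof.
move=> r0; have [c cE] := AC_const v.
have [|||u uE] := @AC_mul _ c (hat (set_val x) r) (2 / r) (rnorm v).
- by move=> z; rewrite cE.
- by move=> s; exact: hat_norm_le1.
- by move=> s t; exact: hat_lip.
exists u; split.
- by rewrite uE hat_center of_real1 scale1r.
- by move=> z /(hat_out r0) z0; rewrite uE z0 of_real0 scale0r.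
- by move=> z; rewrite uE cE rnormZ ler_piMl ?rnorm_ge0 ?hat_norm_le1.
(* [hat] is a difference of two nondecreasing clamps. Their sum [mu] is nondecreasing and its
   increments dominate those of [hat], so the variation telescopes to the total rise of [mu], at
   most 2. *)
pose mu (z : X) := clamp ((set_val z - set_val x) / r + 1) +
  clamp ((set_val z - set_val x) / r).
have umu s z : set_val s < set_val z -> rnorm (u z - u s) <= (mu z - mu s) * rnorm v.
  move=> sz; rewrite !uE !cE -scalerBl -of_realB rnormZ ler_wpM2r ?rnorm_ge0//.
  have le1 : (set_val s - set_val x) / r <= (set_val z - set_val x) / r.
    by rewrite ler_wpM2r ?invr_ge0 ?(ltW r0)//; lra.
  have := clamp_homo le1.
  have : (set_val s - set_val x) / r + 1 <= (set_val z - set_val x) / r + 1 by lra.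
  move=> /clamp_homo; rewrite /mu /hat ler_norml; lra.
move=> t s ts; suff : seq_variation u t s <= (mu (last t s) - mu t) * rnorm v.
  move=> /le_trans; apply; rewrite ler_wpM2r ?rnorm_ge0// /mu.
  set w := last t s.
  have := clamp_le1 ((set_val w - set_val x) / r + 1).
  have := clamp_le1 ((set_val w - set_val x) / r).
  have := clamp_ge0 ((set_val t - set_val x) / r + 1).
  have := clamp_ge0 ((set_val t - set_val x) / r); lra.
elim: s t ts => [|z s ih] t /=; first by rewrite subrr mul0r.
move=> /andP[tz /ih h]; apply: le_trans (lerD (umu _ _ tz) h) _.
by rewrite -mulrDl ler_wpM2r ?rnorm_ge0//; lra.
Qed.

(** The steps of a chain are disjoint intervals whose lengths telescope, so a chain of short span is
    an admissible family in the definition of absolute continuity. *)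
Lemma AC_seq_variation_small E (f : ACspace X E) (e : R) : 0 < e ->
  exists2 d : R, 0 < d & forall t s, increasing_from t s ->
    set_val (last t s) - set_val t < d -> seq_variation f t s < e.
Proof.
move=> e0; have [d d0 Hd] := AC_abs_continuous f e0.
exists d => // t s ts sd; rewrite seq_variationE.
apply: (Hd _ (fun i => nth t (t :: s) i) (fun i => nth t (t :: s) i.+1)).
- by move=> i; apply: increasing_from_nth => //; rewrite ltnSn ltn_ord.
- move=> i j _ _ [z []]; rewrite /= !in_itv/= => /andP[iz zi] /andP[jz zj].
  apply/val_inj/eqP; rewrite eqn_leq; apply/andP; split; rewrite leqNgt; apply/negP => ij.
    have : set_val (nth t (t :: s) j.+1) <= set_val (nth t (t :: s) i).
      have [->//|ji] := eqVneq j.+1 i.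
      by apply/ltW/increasing_from_nth => //; rewrite ltn_neqAle ji ij ltnW.
    rewrite /=; lra.
  have : set_val (nth t (t :: s) i.+1) <= set_val (nth t (t :: s) j).
    have [->//|ji] := eqVneq i.+1 j.
    by apply/ltW/increasing_from_nth => //; rewrite ltn_neqAle ji ij ltnW.
  rewrite /=; lra.
- apply: le_lt_trans sd; rewrite le_eqVlt; apply/orP; left; apply/eqP.
  pose v i := set_val (nth t (t :: s) i).
  by rewrite -(big_mkord xpredT (fun i => v i.+1 - v i)) telescope_sumr// /v nth_last.
Qed.

Lemma AC_uniformly_continuous E (f : ACspace X E) (e : R) : 0 < e ->
  exists2 d : R, 0 < d & forall x y, `|set_val x - set_val y| < d ->
    rnorm (f x - f y) < e.
Proof.
move=> e0; have [d d0 Hd] := AC_seq_variation_small f e0; exists d => // x y.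
wlog xy : x y / set_val x <= set_val y => [h|].
  by case/orP: (le_total (set_val x) (set_val y)) => /h//; rewrite distrC rnormBC.
move: xy; rewrite le_eqVlt => /orP[/eqP|xy xyd].
  by rewrite set_valE => /val_inj-> _; rewrite subrr rnorm0.
have := Hd x [:: y]; rewrite /increasing_from/= xy addr0 rnormBC => -> //.
by move: xyd; rewrite distrC gtr0_norm// subr_gt0.
Qed.

End abs_continuous_functions.

(** * Boundedness and bounded variation on compact sets *)

Section compact_domain.
Context (R : realType) (k : scalar_kind) (X : set R).
Hypothesis cptX : compact X.
Implicit Types (E : normedModType (scalars R k)).

Lemma compact_set_val_bound : exists A : R, forall x : X, `|set_val x| <= A.
Proof.
have [M [_ hM]] := compact_bounded cptX.
by exists (M + 1) => x; apply: (hM (M + 1)); [rewrite ltrDl|exact: set_valP].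
Qed.

(** Finitely many cells of length [d] cover [X], and [f] varies by less than 1 on each. A cell may
    contain no point of [X], hence the case distinction on a reference point [x0]. *)
Lemma AC_bounded E (f : ACspace X E) : exists M : R, forall x, rnorm (f x) <= M.
Proof.
have [A hA] := compact_set_val_bound.
have [d d0 fd] := AC_uniformly_continuous f ltr01.
suff /(_ (Num.bound ((A + A) / d)))[M hM] : forall n, exists M : R, forall x,
    set_val x < - A + n%:R * d -> rnorm (f x) <= M.
  exists M => x; apply: hM.
  have : (A + A) / d < (Num.bound ((A + A) / d))%:R.
    apply: archi_boundP; rewrite divr_ge0 ?(ltW d0)//.
    by have := le_trans (normr_ge0 _) (hA x); lra.
  rewrite ltr_pdivrMr//.
  by have := hA x; rewrite ler_norml => /andP[_]; lra.
elim=> [|n [M hM]].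
  exists 0 => x; have := hA x; rewrite ler_norml mul0r addr0 => /andP[].
  by move=> h _ h'; have := lt_le_trans h' h; rewrite ltxx.
have [[x0 x0n x0n1]|nx0] := pselect (exists2 x0 : X, - A + n%:R * d <= set_val x0 &
    set_val x0 < - A + n.+1%:R * d).
  exists (Num.max M (1 + rnorm (f x0))) => x xn; rewrite le_max.
  have [/hM->//|nx] := ltP (set_val x) (- A + n%:R * d).
  apply/orP; right; apply: le_trans (rnorm_leD _ (f x0)) _; rewrite lerD2r ltW// fd//.
  move: xn x0n1; rewrite -natr1 mulrDl mul1r ltr_norml => ? ?; apply/andP; split; lra.
exists M => x xn; apply: hM; rewrite ltNge; apply/negP => nx.
by apply: nx0; exists x.
Qed.

Lemma seq_variation_cat E (f : X -> E) t s1 s2 :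
  seq_variation f t (s1 ++ s2) = seq_variation f t s1 + seq_variation f (last t s1) s2.
Proof. by elim: s1 t => [|z s1 ih] t /=; rewrite ?add0r// ih addrA. Qed.

(** Cut the chain at its first point at distance at least [d] from the start. The part before the
    cut has variation below 1; the step across the cut may jump over a gap of [X] and is bounded by
    [M + M]; the rest starts [d] closer to the upper bound [A], which drives the induction. *)
Lemma AC_bounded_variation E (f : ACspace X E) : exists V : R,
  forall t s, increasing_from t s -> seq_variation f t s <= V.
Proof.
have [A hA] := compact_set_val_bound.
have [M hM] := AC_bounded f.
have [d d0 fd] := AC_seq_variation_small f ltr01.
pose N := Num.bound ((A + A) / d).
suff H n : forall t s, increasing_from t s -> A - set_val t < n%:R * d ->
    seq_variation f t s <= n%:R * (1 + (M + M)).
  exists (N%:R * (1 + (M + M))) => t s ts; apply: H => //.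
  have : (A + A) / d < N%:R.
    apply: archi_boundP; rewrite divr_ge0 ?(ltW d0)//.
    by have := le_trans (normr_ge0 _) (hA t); lra.
  rewrite ltr_pdivrMr//.
  by have := hA t; rewrite ler_norml => /andP[]; lra.
elim: n => [t s _|n ih t s ts].
  by have := hA t; rewrite ler_norml mul0r => /andP[_]; lra.
rewrite -natr1 !mulrDl !mul1r => tA.
have M0 : 0 <= M by exact: le_trans (rnorm_ge0 _) (hM t).
pose far (z : X) := set_val t + d <= set_val z.
have near s1 : ~~ has far s1 -> set_val (last t s1) - set_val t < d.
  move=> /hasPn s1far; have := mem_last t s1; rewrite inE => /orP[/eqP->|/s1far].
    by rewrite subrr.
  by rewrite /far -ltNge; lra.
have [hs|ns] := boolP (has far s); last first.
  apply: le_trans (ltW (fd _ _ ts (near _ ns))) _.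
  by rewrite -[leLHS]add0r lerD ?mulr_ge0// ?addr_ge0// ?lerDl ?addr_ge0.
case/split_find: hs ts => z s1 s2 zfar ns1.
rewrite /increasing_from cat_path rcons_path last_rcons => /andP[/andP[ts1 s1z] zs2].
rewrite cat_rcons seq_variation_cat /=.
have h1 := ltW (fd _ _ ts1 (near _ ns1)).
have h2 : rnorm (f z - f (last t s1)) <= M + M.
  by apply: le_trans (rnormD _ _) _; rewrite rnormN lerD.
have h3 : seq_variation f z s2 <= n%:R * (1 + (M + M)).
  by apply: ih => //; move: zfar; rewrite /far; lra.
by lra.
Qed.

End compact_domain.

(** * Geometric series of functions and the gliding hump *)

Section series.
Context (R : realType) (k : scalar_kind).
Implicit Types (X : set R) (E : completeNormedModType (scalars R k)).

Let h : R := 2^-1.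

Lemma half_exp_gt0 n : 0 < h ^+ n.
Proof. by apply: exprn_gt0; rewrite invr_gt0. Qed.

Lemma half_exp_small (e : R) : 0 < e -> exists N, forall n, (N <= n)%N -> h ^+ n < e.
Proof.
move=> e0; have [N _ hN] := near_infty_natSinv_expn_lt (PosNum e0).
by exists N => n /hN /=; rewrite div1r /h exprVn.
Qed.

Lemma half_exp_sum n m : \sum_(n <= i < m) h ^+ i <= 2 * h ^+ n.
Proof.
have [nm|/ltnW mn] := leqP n m; last first.
  by rewrite big_geq// mulr_ge0// ltW// half_exp_gt0.
suff -> : \sum_(n <= i < m) h ^+ i = 2 * h ^+ n - 2 * h ^+ m.
  by rewrite gerBl mulr_ge0// ltW// half_exp_gt0.
elim: m nm => [|m ih]; first by rewrite leqn0 => /eqP->; rewrite big_nil subrr.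
rewrite leq_eqVlt => /orP[/eqP->|]; first by rewrite big_geq// subrr.
rewrite ltnS => nm; rewrite big_nat_recr//= ih// exprS /h.
by field.
Qed.

Lemma geometric_series_cvg E (u : nat -> E) : (forall n, rnorm (u n) <= h ^+ n) ->
  exists v : E, forall e : R, 0 < e -> exists N, forall n, (N <= n)%N ->
    rnorm (v - \sum_(0 <= i < n) u i) < e.
Proof.
move=> uh.
have /cauchy_cvg : cauchy (series u @ \oo).
  apply/cauchy_seriesP => e e0.
  have e0' : 0 < to_real e / 2.
    by rewrite divr_gt0// -(of_real_gt0 k) of_realK_ge0// ltW.
  have [N hN] := half_exp_small e0'.
  exists ([set n | (N <= n)%N], [set n | (N <= n)%N]); first by split; exists N.
  move=> [n m] [/= Nn Nm]; rewrite normrE -[e]of_realK_ge0 ?(ltW e0)// ltr_of_real.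
  apply: le_lt_trans (rnorm_sum _ _ _) _.
  apply: le_lt_trans (ler_sum _ (fun i _ => uh i)) _.
  by apply: le_lt_trans (half_exp_sum n m) _; rewrite mulrC -ltr_pdivlMr// hN.
case/cvg_ex => v /cvgrPdist_lt hv; exists v => e e0.
have [|N _ hN] := hv (of_real k e); first by rewrite of_real_gt0.
by exists N => n /hN; rewrite normrE ltr_of_real.
Qed.

(** The local factor [c] records where later terms are smaller; at a point with [c = 0] the limit
    equals the partial sum. *)
Lemma geometric_series_tail E (u : nat -> E) (v : E) :
  (forall e : R, 0 < e -> exists N, forall n, (N <= n)%N ->
    rnorm (v - \sum_(0 <= i < n) u i) < e) ->
  forall n c, (forall m, (n <= m)%N -> rnorm (u m) <= h ^+ m * c) ->
    rnorm (v - \sum_(0 <= i < n) u i) <= 2 * h ^+ n * c.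
Proof.
move=> uv n c uc.
have c0 : 0 <= c.
  by have := le_trans (rnorm_ge0 _) (uc n (leqnn n)); rewrite pmulr_rge0 ?half_exp_gt0.
apply/ler_addgt0Pr => e e0; have [N hN] := uv _ e0.
have hv := hN _ (leq_maxl N n).
rewrite [leRHS]addrC; apply: le_trans (rnorm_triangle (\sum_(0 <= i < maxn N n) u i) _ _) _.
apply: lerD; first exact: ltW.
rewrite (big_cat_nat (leq0n n) (leq_maxr N n))/= addrAC subrr add0r.
apply: le_trans (rnorm_sum _ _ _) _.
apply: (@le_trans _ _ (\sum_(n <= i < maxn N n) h ^+ i * c)).
  by rewrite big_nat [leRHS]big_nat; apply: ler_sum => i /andP[+ _]; exact: uc.
by rewrite -mulr_suml ler_wpM2r// half_exp_sum.
Qed.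

Lemma disjoint_intervals_le X E (f : X -> E) (c : R) (m : nat) (a b : 'I_m -> X) :
  0 <= c -> (forall t s, increasing_from t s -> seq_variation f t s <= c) ->
  (forall i, set_val (a i) < set_val (b i)) ->
  trivIset setT (fun i => `]set_val (a i), set_val (b i)[%classic) ->
  \sum_(i < m) rnorm (f (b i) - f (a i)) <= c.
Proof.
case: m a b => [|m] a b c0 fc ab tab; first by rewrite big_ord0.
case: (@Order.TotalTheory.arg_minP _ R _ ord0 xpredT
  (fun i => set_val (a i)) isT) => i0 _ i0min.
have [|s ts] := disjoint_intervals_seq f (A := [set: 'I_m.+1]%SET) (t := a i0) ab tab.
  by move=> i _; exact: i0min.
rewrite (eq_bigl xpredT) => [/le_trans|i]; last by rewrite inE.
by apply; exact: fc.
Qed.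

(** The increment sum of the limit splits in three: the partial sum up to [N] is absolutely
    continuous, the terms from [N] to [M] cost at most their total variation whatever the family,
    and the tail past [M] is small pointwise. *)
Lemma AC_series X E (u : nat -> ACspace X E) :
  (forall n x, rnorm (u n x) <= h ^+ n) ->
  (forall n t s, increasing_from t s -> seq_variation (u n) t s <= h ^+ n) ->
  exists f : ACspace X E, forall x n c,
    (forall m, (n <= m)%N -> rnorm (u m x) <= h ^+ m * c) ->
    rnorm (f x - \sum_(0 <= i < n) u i x) <= 2 * h ^+ n * c.
Proof.
move=> usup uvar.
have [f hf] : exists f : X -> E, forall x (e : R), 0 < e ->
    exists N, forall n, (N <= n)%N -> rnorm (f x - \sum_(0 <= i < n) u i x) < e.
  have [f hf] := choice (fun x => geometric_series_cvg (fun n => usup n x)).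
  by exists f.
have ftail x n : rnorm (f x - \sum_(0 <= i < n) u i x) <= 2 * h ^+ n.
  rewrite -[leRHS]mulr1; apply: (geometric_series_tail (hf x)) => m _.
  by rewrite mulr1.
suff /AC_exists[g gf] : abs_continuous f.
  by exists g => x n c uc; rewrite gf; apply: (geometric_series_tail (hf x)).
move=> e e0; have e8 : 0 < e / 8 by rewrite divr_gt0.
have [N /(_ _ (leqnn N)) hN] := half_exp_small e8.
have e2 : 0 < e / 2 by rewrite divr_gt0.
pose S n := \sum_(0 <= i < n) u i.
have SE n x : S n x = \sum_(0 <= i < n) u i x by rewrite AC_sumE.
have [d d0 Hd] := AC_abs_continuous (S N) e2.
exists d => // m a b ab tab /(Hd m a b ab tab) SN.
(* [M] may depend on the family: the pointwise estimate of the tail is paid once per interval, hence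
   the division by the number of intervals. *)
have em : 0 < e / (16 * m.+1%:R) by rewrite divr_gt0// mulr_gt0.
have [M0 /(_ _ (leq_maxl M0 N))] := half_exp_small em.
set M := maxn M0 N => hM; have NM : (N <= M)%N by exact: leq_maxr.
have step i : rnorm (f (b i) - f (a i)) <= rnorm (S N (b i) - S N (a i)) +
    (\sum_(N <= j < M) rnorm (u j (b i) - u j (a i)) + 4 * h ^+ M).
  have SMN x : S M x = S N x + \sum_(N <= j < M) u j x.
    by rewrite !SE (big_cat_nat (leq0n N) NM).
  have -> : f (b i) - f (a i) = (S N (b i) - S N (a i)) +
      (\sum_(N <= j < M) (u j (b i) - u j (a i)) +
        ((f (b i) - S M (b i)) - (f (a i) - S M (a i)))).
    have fE x : f x = S N x + (\sum_(N <= j < M) u j x + (f x - S M x)).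
      by rewrite addrA -SMN addrC subrK.
    rewrite [in LHS](fE (b i)) [in LHS](fE (a i)) sumrB.
    by rewrite opprD addrACA; congr (_ + _); rewrite opprD addrACA.
  apply: le_trans (rnormD _ _) _; rewrite lerD2l; apply: le_trans (rnormD _ _) _.
  apply: lerD; first exact: rnorm_sum.
  apply: le_trans (rnormD _ _) _; rewrite rnormN !SE.
  by have := ftail (b i) M; have := ftail (a i) M; lra.
apply: le_lt_trans (ler_sum _ (fun i _ => step i)) _.
rewrite !big_split/= exchange_big/= sumr_const card_ord -mulr_natr.
have uN : \sum_(N <= j < M) \sum_(i < m) rnorm (u j (b i) - u j (a i)) <= 2 * h ^+ N.
  apply: le_trans _ (half_exp_sum N M); apply: ler_sum => j _.
  apply: (disjoint_intervals_le _ _ ab tab) => //; first exact/ltW/half_exp_gt0.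
  exact: uvar.
have hm : 4 * h ^+ M * m%:R <= e / 4.
  move: hM; rewrite ltr_pdivlMr ?mulr_gt0// => hM.
  rewrite ler_pdivlMr//; have : h ^+ M * m%:R <= h ^+ M * m.+1%:R.
    by rewrite ler_wpM2l ?ler_nat// ltW// half_exp_gt0.
  have -> : 4 * h ^+ M * m%:R * 4 = 16 * (h ^+ M * m%:R) by ring.
  by move: hM; rewrite mulrCA; lra.
by lra.
Qed.

End series.

(* The terms are added one at a time; each u is kept or discarded so that its own
   functional p i becomes large, and later terms lie in the region where p i <= 1. *)
Lemma gliding_hump (R : realType) (k : scalar_kind) (X : set R)
    (E : completeNormedModType (scalars R k)) (I : eqType) (Q : I -> Prop)
    (p : I -> ACspace X E -> R) (c : I -> X -> R) :
  (forall i f g, p i (f + g) <= p i f + p i g) ->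
  (forall i f, p i (- f) = p i f) ->
  (forall i (u : ACspace X E), Q i -> (forall x, rnorm (u x) <= c i x) -> p i u <= 1) ->
  (forall (s : seq I) (M e : R), 0 < e -> exists (i : I) (u : ACspace X E),
    [/\ Q i /\ M <= p i u, forall x, rnorm (u x) <= e,
        forall t r, increasing_from t r -> seq_variation u t r <= e &
        forall j, j \in s -> forall x, rnorm (u x) <= e * c j x]) ->
  exists f : ACspace X E, forall M, exists2 i, Q i & M <= p i f.
Proof.
move=> pD pN pc hump; pose h : R := 2^-1.
have c0 i : (exists x, c i x < 0) -> False.
  move=> [x ci]; have [_ [u [_ _ _ /(_ i)]]] := hump [:: i] 0 1 ltr01.
  rewrite inE eqxx => /(_ isT x); rewrite mul1r => /(le_lt_trans)/(_ ci).
  by rewrite ltNge rnorm_ge0.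
have {}c0 i x : 0 <= c i x by rewrite leNgt; apply/negP => ci; apply: (c0 i); exists x.
(* The factor 2 pays for keeping or discarding [u]: since [p u] is at most the sum of [p] at the
   partial sums with and without [u], one of these two values reaches [n.+1]. *)
have hump' (sn : seq I * nat) : exists iu : I * ACspace X E,
    [/\ Q iu.1 /\ 2 * sn.2.+1%:R <= p iu.1 iu.2, forall x, rnorm (iu.2 x) <= h ^+ sn.2,
        forall t r, increasing_from t r -> seq_variation iu.2 t r <= h ^+ sn.2 &
        forall j, j \in sn.1 -> forall x, rnorm (iu.2 x) <= h ^+ sn.2 * c j x].
  have [i [u H]] := hump sn.1 (2 * sn.2.+1%:R) _ (half_exp_gt0 R sn.2).
  by exists (i, u).
have [F FP] := choice hump'.
pose step n (sg : seq I * ACspace X E) :=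
  let iu := F (sg.1, n) in
  (iu.1 :: sg.1, if n.+1%:R <= p iu.1 (sg.2 + iu.2) then sg.2 + iu.2 else sg.2).
pose st := fix st n := if n is n'.+1 then step n' (st n') else ([::], 0).
pose idx n := (F ((st n).1, n)).1.
pose u n := (F ((st n).1, n)).2.
pose w n := (st n.+1).2 - (st n).2.
have wE n : w n = u n \/ w n = 0.
  rewrite /w /= /step/=; case: ifP => _; last by right; rewrite subrr.
  by left; rewrite addrAC subrr add0r.
have sumw n : \sum_(0 <= i < n) w i = (st n).2 by rewrite telescope_sumr// subr0.
have wsup n x : rnorm (w n x) <= h ^+ n.
  case: (wE n) => ->; last by rewrite AC_zeroE rnorm0 ltW// half_exp_gt0.
  by have [_ + _ _] := FP ((st n).1, n); apply.
have wvar n t r : increasing_from t r -> seq_variation (w n) t r <= h ^+ n.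
  case: (wE n) => -> tr.
    by have [_ _ + _] := FP ((st n).1, n); apply.
  suff -> : seq_variation (0 : ACspace X E) t r = 0 by rewrite ltW// half_exp_gt0.
  by elim: r t {tr} => //= z r ih t; rewrite ih subrr rnorm0 addr0.
have idx_mem n m : (n < m)%N -> idx n \in (st m).1.
  elim: m => // m ih; rewrite ltnS leq_eqVlt => /orP[/eqP<-|/ih nm].
    by rewrite /= inE eqxx.
  by rewrite /= inE nm orbT.
have wc n m x : (n < m)%N -> rnorm (w m x) <= h ^+ m * c (idx n) x.
  move=> nm; case: (wE m) => ->.
    by have [_ _ _] := FP ((st m).1, m); apply; exact: idx_mem.
  by rewrite AC_zeroE rnorm0 mulr_ge0// ltW// half_exp_gt0.
have pge n : n.+1%:R <= p (idx n) (st n.+1).2.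
  have [[_ +] _ _ _] := FP ((st n).1, n); rewrite -/(idx n) -/(u n) => pu.
  rewrite /= /step/= -/(idx n) -/(u n); case: ifP => // /negbT; rewrite -ltNge => lt1.
  have := pD (idx n) ((st n).2 + u n) (- (st n).2).
  rewrite pN addrAC subrr add0r => h1.
  by move: pu; rewrite [_.2]/=; lra.
have [f hf] := AC_series wsup wvar; exists f => M.
pose n := Num.bound `|M|; exists (idx n).
  by have [[]] := FP ((st n).1, n).
(* The tail starts at [n.+1], so its bound [2 * h ^+ n.+1 * c] equals [h ^+ n * c], which is at most
   [c]; the limit thus loses at most 1 from [n.+1]. *)
have pf : p (idx n) (f - (st n.+1).2) <= 1.
  apply: pc => [|x]; first by have [[]] := FP ((st n).1, n).
  have := hf x n.+1 (c (idx n) x) (fun m nm => wc n m x nm).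
  rewrite AC_subE -sumw AC_sumE => /le_trans; apply.
  rewrite -[leRHS]mul1r ler_wpM2r// exprS mulrA divff// mul1r.
  by rewrite exprn_ile1 ?invr_ge0// invf_le1 ?ler1n.
have := pD (idx n) f (- (f - (st n.+1).2)); rewrite pN opprB addrCA subrr addr0.
have := pge n; rewrite -natr1.
have : M <= n%:R by apply: le_trans (ler_norm M) _; exact/ltW/archi_boundP.
by lra.
Qed.

(** * Splitting a function at a zero by oscillating cut-offs of its norm *)

Section oscillation.
Context (R : realType) (k : scalar_kind).

Definition vanishes_near (X : set R) (E : normedModType (scalars R k))
    (f : ACspace X E) (x : X) :=
  exists2 e : R, 0 < e & forall z, `|set_val z - set_val x| < e -> f z = 0.

Definition radial (E : normedModType (scalars R k)) (p : R -> R) (v : E) : E :=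
  of_real k (p (rnorm v) / rnorm v) *: v.

(** The quotient [p s / s] is at most 1, which handles [u - v]. The difference of quotients is
    multiplied by [t], and [(p s / s - p t / t) * t = (p s / s) * (t - s) + (p s - p t)] contains no
    division by [t]; this contributes [L + 1]. *)
Lemma radial_lip (E : normedModType (scalars R k)) (p : R -> R) (L : R) :
  (forall s, 0 <= s -> 0 <= p s) -> (forall s, 0 <= s -> p s <= s) ->
  (forall s t, 0 <= s -> 0 <= t -> `|p s - p t| <= L * `|s - t|) ->
  0 < L -> forall u v : E, rnorm (radial p u - radial p v) <= (L + 2) * rnorm (u - v).
Proof.
move=> p0 pid pL L0 u v; rewrite /radial.
set s := rnorm u; set t := rnorm v.
have s0 : 0 <= s := rnorm_ge0 u; have t0 : 0 <= t := rnorm_ge0 v.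
have pK w : 0 <= w -> p w / w * w = p w.
  rewrite le_eqVlt => /orP[/eqP<-|w0]; last by rewrite divfK// gt_eqF.
  by rewrite mulr0; apply/le_anti; rewrite p0// pid.
have a1 : `|p s / s| <= 1.
  rewrite ger0_norm ?divr_ge0 ?p0//; move: s0; rewrite le_eqVlt => /orP[/eqP<-|s0].
    by rewrite invr0 mulr0.
  by rewrite ler_pdivrMr// mul1r pid// ltW.
have -> : of_real k (p s / s) *: u - of_real k (p t / t) *: v =
    of_real k (p s / s) *: (u - v) + of_real k (p s / s - p t / t) *: v.
  by rewrite of_realB scalerBr scalerBl addrA subrK.
apply: le_trans (rnormD _ _) _; rewrite !rnormZ -/t.
have st : `|s - t| <= rnorm (u - v) := rnorm_dist u v.
have h1 : `|p s / s| * rnorm (u - v) <= rnorm (u - v) by rewrite ler_piMl ?rnorm_ge0.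
have h2 : `|p s / s - p t / t| * t <= (L + 1) * `|s - t|.
  have -> : `|p s / s - p t / t| * t = `|(p s / s) * (t - s) + (p s - p t)|.
    transitivity (`|p s / s - p t / t| * `|t|); first by rewrite (ger0_norm t0).
    by rewrite -normrM mulrBl mulrBr !pK//; congr `|_|; ring.
  apply: le_trans (ler_normD _ _) _; rewrite addrC mulrDl lerD ?pL// normrM mul1r.
  by rewrite [`|t - s|]distrC ler_piMl.
have h3 : (L + 1) * `|s - t| <= (L + 1) * rnorm (u - v).
  by rewrite ler_wpM2l// addr_ge0// ltW.
have -> : (L + 2) * rnorm (u - v) = rnorm (u - v) + (L + 1) * rnorm (u - v) by ring.
by apply: lerD => //; apply: le_trans h2 h3.
Qed.

(* A function below the identity that vanishes around every a n but equals the
   identity at scales that are separated from all the a n by a factor of 4. *)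
Definition notch (a : nat -> R) (s : R) : R :=
  inf (range (fun n => Num.max 0 (Num.min s (8 * `|s - a n| - a n)))).

Lemma notch_le a s n : notch a s <= Num.max 0 (Num.min s (8 * `|s - a n| - a n)).
Proof.
apply: ge_inf; last by exists n.
by exists 0 => _ [m _ <-]; rewrite le_max lexx.
Qed.

Lemma notch_ge a s c :
  (forall n, c <= Num.max 0 (Num.min s (8 * `|s - a n| - a n))) -> c <= notch a s.
Proof.
move=> h; apply: lb_le_inf; first exact: image_nonempty.
by move=> _ [n _ <-].
Qed.

Lemma notch_ge0 a s : 0 <= notch a s.
Proof. by apply: notch_ge => n; rewrite le_max lexx. Qed.

Lemma notch_le_id a s : 0 <= s -> notch a s <= s.
Proof.
by move=> s0; apply: le_trans (notch_le _ _ 0%N) _; rewrite ge_max s0 ge_min lexx.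
Qed.

(** Every member of the family is 8-Lipschitz in [s], and an infimum of such functions inherits the
    constant. *)
Lemma notch_lip a s t : `|notch a s - notch a t| <= 8 * `|s - t|.
Proof.
have H u v : notch a u <= notch a v + 8 * `|u - v|.
  rewrite -lerBlDr; apply: notch_ge => n.
  rewrite lerBlDr; apply: le_trans (notch_le _ _ n) _.
  have d0 : 0 <= `|u - v| by [].
  have h1 : `|u - a n| <= `|u - v| + `|v - a n|.
    by have := ler_normD (u - v) (v - a n); rewrite addrA subrK.
  have h2 := ler_norm (u - v).
  rewrite ge_max; apply/andP; split.
    by rewrite addr_ge0 ?mulr_ge0// le_max lexx.
  rewrite -lerBlDr le_max le_min; apply/orP; right; apply/andP; split.
    have : Num.min u (8 * `|u - a n| - a n) <= u by rewrite ge_min lexx.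
    by lra.
  have : Num.min u (8 * `|u - a n| - a n) <= 8 * `|u - a n| - a n by rewrite ge_min lexx orbT.
  by lra.
by rewrite ler_norml; have := H s t; have := H t s; rewrite [`|t - s|]distrC; lra.
Qed.

Lemma notch_eq0 a s n : 8 * `|s - a n| <= a n -> notch a s = 0.
Proof.
move=> h; apply/le_anti; rewrite notch_ge0 andbT.
apply: le_trans (notch_le _ _ n) _; rewrite ge_max lexx/= ge_min.
by apply/orP; right; lra.
Qed.

(** Here [s] lies between [7b/8] and [9b/8]. If [a n >= 4b] then [7 a n - 8 s >= 19b]; if
    [a n <= b/4] then [8 s - 9 a n >= 19b/4]. Both exceed [s], so no notch is active. *)
Lemma notch_id a s b : 0 < b -> 8 * `|s - b| <= b ->
  (forall n, 4 * b <= a n \/ 0 <= a n /\ 4 * a n <= b) -> notch a s = s.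
Proof.
move=> b0 sb ab.
have [sb1 sb2] : s - b <= b / 8 /\ b - s <= b / 8.
  have := ler_norm (s - b); have := ler_norm (b - s); rewrite [`|b - s|]distrC; lra.
apply/le_anti; rewrite notch_le_id ?andbT; last by lra.
apply: notch_ge => n; rewrite le_max le_min lexx/=; apply/orP; right.
have := ler_norm (s - a n); have := ler_norm (a n - s); rewrite [`|a n - s|]distrC.
by case: (ab n); lra.
Qed.

Lemma AC_oscillation_split (X : set R) (E : normedModType (scalars R k))
    (f : ACspace X E) (x : X) : f x = 0 -> ~ vanishes_near f x ->
  exists f1 f2 : ACspace X E, [/\ f = f1 + f2,
    forall e : R, 0 < e -> exists2 z, `|set_val z - set_val x| < e & vanishes_near f1 z &
    forall e : R, 0 < e -> exists2 z, `|set_val z - set_val x| < e & vanishes_near f2 z].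
Proof.
move=> fx nv.
have Gex (r : R) : exists z : X, 0 < r ->
    `|set_val z - set_val x| < r /\ 0 < rnorm (f z) /\ 4 * rnorm (f z) <= r.
  have [r0|r0] := ltP 0 r; last by exists x.
  have r4 : 0 < r / 4 by rewrite divr_gt0.
  have [d d0 hd] := AC_uniformly_continuous f r4.
  have [z [zx fz]] : exists z : X, `|set_val z - set_val x| < Num.min d r /\ f z <> 0.
    apply: contrapT => nz; apply: nv; exists (Num.min d r); first by rewrite lt_min d0.
    by move=> z zx; apply: contrapT => fz; apply: nz; exists z.
  exists z => _; move: zx; rewrite lt_min => /andP[zd zr]; split => //; split.
    by rewrite rnorm_gt0; apply/eqP.
  by have := hd _ _ zd; rewrite fx subr0; lra.
have [G HG] := choice Gex.
(* One recursion controls both quantities: [G (r n)] is within [r n] of [x], and the norm of [f]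
   there is [r n.+1], at most a quarter of [r n]. *)
pose r := fix r n : R := if n is n'.+1 then rnorm (f (G (r n'))) else 1.
have r0 n : 0 < r n by elim: n => //= n ih; have [_ []] := HG _ ih.
have rS n : 4 * r n.+1 <= r n by have [_ []] := HG _ (r0 n).
have rlt i j : (i < j)%N -> 4 * r j <= r i.
  elim: j => // j ih; rewrite ltnS leq_eqVlt => /orP[/eqP->//|/ih].
  by have := rS j; have := r0 j.+1; lra.
have rh n : r n <= 2^-1 ^+ n.
  elim: n => //= n ih; have := rS n; have := r0 n.+1.
  by rewrite exprS [r n.+1]/=; lra.
have Gx (e : R) : 0 < e -> exists N, forall n, (N <= n)%N ->
    `|set_val (G (r n)) - set_val x| < e.
  move=> e0; have [N hN] := half_exp_small e0; exists N => n /hN.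
  by have [+ _] := HG _ (r0 n); have := rh n; lra.
(* The notches sit at the norms of [f] at the points of even index, near which [f1] vanishes. At the
   points of odd index the norms are separated from the notches by the factor 4, so [f1 = f] nearby
   and [f2] vanishes. *)
pose a n := r n.*2.+1.
have aE n : a n = rnorm (f (G (r n.*2))) by [].
have near_norm z : 0 < rnorm (f z) -> exists2 e : R, 0 < e &
    forall w, `|set_val w - set_val z| < e -> 8 * `|rnorm (f w) - rnorm (f z)| <= rnorm (f z).
  move=> fz; have fz8 : 0 < rnorm (f z) / 8 by rewrite divr_gt0.
  have [d d0 hd] := AC_uniformly_continuous f fz8; exists d => // w /hd.
  by have := rnorm_dist (f w) (f z); lra.
have rad : forall u v : E,
    rnorm (radial (notch a) u - radial (notch a) v) <= (8 + 2) * rnorm (u - v).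
  apply: radial_lip => //; [by move=> *; exact: notch_ge0|exact: notch_le_id|].
  by move=> *; exact: notch_lip.
have [f1 f1E] := AC_comp_lip f (addr_gt0 (ltr0n R 8) (ltr0n R 2)) rad.
exists f1, (f - f1); split; first by rewrite addrC subrK.
- move=> e /Gx[N hN]; exists (G (r N.*2)); first by apply: hN; rewrite -addnn leq_addr.
  have [|d d0 hd] := near_norm (G (r N.*2)); first exact: (r0 N.*2.+1).
  exists d => // w /hd; rewrite -aE => /notch_eq0 n0.
  by rewrite f1E /radial n0 mul0r of_real0 scale0r.
- move=> e /Gx[N hN]; exists (G (r N.*2.+1)).
    by apply: hN; rewrite ltnW// ltnS -addnn leq_addr.
  have b0 : 0 < rnorm (f (G (r N.*2.+1))) := r0 N.*2.+2.
  have [|d d0 hd] := near_norm (G (r N.*2.+1)); first exact: b0.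
  exists d => // w /hd hw; rewrite AC_subE f1E /radial (notch_id b0 hw).
    have [->|fw] := eqVneq (f w) 0; first by rewrite scaler0 subr0.
    by rewrite divff ?of_real1 ?scale1r ?subrr// gt_eqF// rnorm_gt0.
  move=> n; have := r0 n.*2.+1; rewrite -/(a n) => an0.
  have [nN|Nn] := leqP n N; [left|right; split; first exact: ltW].
    by apply: (rlt n.*2.+1 N.*2.+2); rewrite ltnS ltnS leq_double.
  by apply: (rlt N.*2.+2 n.*2.+1); rewrite ltnS -doubleS leq_double.
Qed.

End oscillation.

Section linear_maps.
Context (K : pzRingType) (U V : lmodType K) (T : U -> V).
Hypothesis linT : linear T.

Lemma linear_subE u v : T (u - v) = T u - T v.
Proof. by rewrite addrC -scaleN1r linT scaleN1r addrC. Qed.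

Lemma linear_zeroE : T 0 = 0.
Proof. by rewrite -{1}(subrr (0 : U)) linear_subE subrr. Qed.

Lemma linear_oppE u : T (- u) = - T u.
Proof. by rewrite -sub0r linear_subE linear_zeroE sub0r. Qed.

Lemma linear_addE u v : T (u + v) = T u + T v.
Proof. by rewrite -{1}(opprK v) linear_subE linear_oppE opprK. Qed.

Lemma linear_scaleE c u : T (c *: u) = c *: T u.
Proof. by rewrite -{1}(addr0 (c *: u)) linT linear_zeroE addr0. Qed.

End linear_maps.

(** * Support points of a separating map *)

Section support_points.
Context (R : realType) (k : scalar_kind) (X Y : set R)
  (E F : normedModType (scalars R k)) (T : ACspace X E -> ACspace Y F).
Hypothesis cptX : compact X.
Hypothesis sepT : separating T.

Let linT : linear T. Proof. by case: sepT. Qed.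

Definition support_point (y : Y) (x : X) := forall e : R, 0 < e ->
  exists2 f : ACspace X E, T f y != 0 &
    forall z, e <= `|set_val z - set_val x| -> f z = 0.

Lemma separating_disjoint (f g : ACspace X E) (y : Y) :
  (forall z, f z = 0 \/ g z = 0) -> T f y != 0 -> T g y = 0.
Proof.
move=> fg Tf; apply/eqP/negPn/negP => Tg; case: sepT => _ /(_ f g) sep.
have /sep/seteqP[/(_ y) h _] : cozero f `&` cozero g = set0.
  apply/seteqP; split => // z [/= fz gz].
  by case: (fg z); apply/eqP.
by apply: h; split.
Qed.

Lemma closed_point (x0 : R) :
  (forall e : R, 0 < e -> exists x : X, `|set_val x - x0| < e) ->
  exists x : X, set_val x = x0.
Proof.
move=> hx; have Xx0 : X x0.
  apply: (compact_closed (@Rhausdorff R) cptX) => B /nbhs_ballP[e /= e0 eB].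
  have [x xe] := hx e e0; exists (set_val x); split; first exact: set_valP.
  by apply: eB; rewrite -ball_normE/= distrC.
by exists (exist _ x0 (mem_set Xx0)); rewrite set_valE.
Qed.

(* x is the supremum of the t such that T f y = 0 for all f vanishing on [t, oo). *)
Lemma support_point_exists (y : Y) :
  (exists f, T f y != 0) -> exists x, support_point y x.
Proof.
move=> [f0 Tf0]; have [A hA] := compact_set_val_bound cptX.
pose P (t : R) := forall f : ACspace X E, (forall z, t <= set_val z -> f z = 0) -> T f y = 0.
have P0 : P (- A).
  move=> f fz; suff -> : f = 0 by rewrite linear_zeroE.
  by apply: AC_ext => z; rewrite fz//; have := hA z; rewrite ler_norml => /andP[].
have PA t : P t -> t <= A.
  move=> Pt; rewrite leNgt; apply/negP => At; move/eqP : Tf0; apply.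
  apply: Pt => z; have := hA z; rewrite ler_norml => /andP[_ zA tz].
  by exfalso; lra.
have supP : has_sup [set t | P t] by split; [exists (- A)|exists A].
pose x0 := sup [set t | P t].
have loc (e : R) : 0 < e -> exists2 f : ACspace X E, T f y != 0 &
    forall z, 2 * e <= `|set_val z - x0| -> f z = 0.
  move=> e0; have [t Pt xt] := sup_adherent e0 supP.
  have : ~ P (x0 + e).
    by move=> Px; have := ub_le_sup (proj2 supP) Px; rewrite -/x0; lra.
  move=> /existsNP[f /not_implyP[fz /eqP Tf]].
  have [M hM] := AC_bounded cptX f.
  (* The ramp falls from 1 at [x0 - 2e] to 0 at [x0 - e], and [t > x0 - e] gives [T g y = 0]. Thus
     [f - g] keeps the nonzero value and lives within [2e] of [x0]. *)
  have [||g gE] := @AC_mul _ _ _ _ f (fun t => clamp ((x0 - e - t) / e)) e^-1 M hM.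
  - by move=> s; rewrite ger0_norm ?clamp_ge0 ?clamp_le1.
  - move=> s s'; apply: le_trans (clamp_lip _ _) _.
    rewrite -mulrBl normrM mulrC [`|e^-1|]gtr0_norm ?invr_gt0//.
    have -> : x0 - e - s - (x0 - e - s') = s' - s by ring.
    by rewrite distrC.
  have Tg : T g y = 0.
    apply: Pt => z tz; rewrite gE clamp_le0 ?of_real0 ?scale0r//.
    by rewrite pmulr_lle0 ?invr_gt0//; move: xt; rewrite -/x0; lra.
  exists (f - g); first by rewrite linear_subE// AC_subE Tg subr0.
  move=> z; rewrite ler_normr => /orP[] ze.
    have -> : (f - g) z = f z - g z by [].
    by rewrite gE fz ?scaler0 ?subr0//; lra.
  rewrite AC_subE gE clamp_ge1 ?of_real1 ?scale1r ?subrr//.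
  by rewrite ler_pdivlMr//; lra.
(* If [X] missed a neighbourhood of [x0], a function from [loc] would be 0 on all of [X]. *)
have [e e0|x xx0] := closed_point (x0 := x0).
  apply: contrapT => nx; have e2 : 0 < e / 2 by rewrite divr_gt0.
  have [f Tf fz] := loc _ e2; move/eqP : Tf; apply.
  suff -> : f = 0 by rewrite linear_zeroE.
  apply: AC_ext => z; rewrite fz// mulrC divfK// leNgt; apply/negP => ze.
  by apply: nx; exists z.
exists x => e e0; have e2 : 0 < e / 2 by rewrite divr_gt0.
have [f Tf fz] := loc _ e2; exists f => // z; rewrite xx0 => ze.
by apply: fz; lra.
Qed.

Lemma support_point_local (y : Y) (x : X) (f : ACspace X E) :
  support_point y x -> vanishes_near f x -> T f y = 0.
Proof.
move=> yx [e e0 fe]; have [g Tg ge] := yx e e0.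
apply: separating_disjoint Tg => z.
by have [/ge|/fe] := leP e `|set_val z - set_val x|; [left|right].
Qed.

Lemma AC_neq0_near (f : ACspace Y F) (y : Y) : f y != 0 ->
  exists2 d : R, 0 < d & forall y', `|set_val y' - set_val y| < d -> f y' != 0.
Proof.
move=> fy; have fy0 : 0 < rnorm (f y) by rewrite rnorm_gt0.
have [d d0 hd] := AC_uniformly_continuous f fy0; exists d => // y' /hd.
by apply: contraTneq => ->; rewrite sub0r rnormN ltxx.
Qed.

(** A function [g] living within [e / 2] of [h y] with [T g y] nonzero has [T g] nonzero near [y].
    At a point [y'] with [h y'] at distance at least [e], it would vanish near [h y'], forcing
    [T g y' = 0]. *)
Lemma support_map_continuous (h : Y -> X) : (forall y, support_point y (h y)) ->
  forall y (e : R), 0 < e -> exists2 d : R, 0 < d &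
    forall y', `|set_val y' - set_val y| < d -> `|set_val (h y') - set_val (h y)| < e.
Proof.
move=> hs y e e0; have e2 : 0 < e / 2 by rewrite divr_gt0.
have [g Tg ge] := hs y _ e2; have [d d0 hd] := AC_neq0_near Tg.
exists d => // y' /hd; rewrite ltNge; apply: contraNN => hy'; apply/eqP.
apply: support_point_local (hs y') _; exists (e / 2) => // z zy'; apply: ge.
have := ler_normB (set_val z - set_val (h y)) (set_val z - set_val (h y')).
have -> : set_val z - set_val (h y) - (set_val z - set_val (h y')) =
  set_val (h y') - set_val (h y) by ring.
by lra.
Qed.

End support_points.

(** * Mutually inverse support maps, and locality at a single point *)

Section inverse_support_maps.
Context (R : realType) (k : scalar_kind) (X Y : set R)
  (E F : normedModType (scalars R k))
  (T : ACspace X E -> ACspace Y F) (S : ACspace Y F -> ACspace X E).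
Hypothesis cptX : compact X.
Hypothesis cptY : compact Y.
Hypothesis sepT : separating T.
Hypothesis sepS : separating S.
Hypothesis SK : cancel S T.
Variables (h : Y -> X) (g : X -> Y).
Hypothesis hT : forall y, support_point T y (h y).
Hypothesis gS : forall x, support_point S x (g x).

(** If [g (h y)] differs from [y], cut a function [T f] with nonzero value at [y] by a hat that
    vanishes near [g z] for all [z] close to [h y]. The result [b] has [S b = 0] near [h y], so
    [b y = T (S b) y = 0], a contradiction. *)
Lemma support_mapK : cancel h g.
Proof.
move=> y; apply/eqP; rewrite -(inj_eq val_inj) -!set_valE; apply/negPn/negP => gy.
pose r := `|set_val (g (h y)) - set_val y| / 2.
have r0 : 0 < r by rewrite divr_gt0// normr_gt0 subr_eq0.
have [d d0 hd] := support_map_continuous sepS gS (h y) r0.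
have [f Tf fd] := hT y d0.
have [M hM] := AC_bounded cptY (T f).
have [b bE] := AC_mul hM (hat_norm_le1 (set_val y) r) (fun s t => hat_lip (set_val y) s t r0).
have Sb : vanishes_near (S b) (h y).
  exists d => // z /hd zr; apply: support_point_local sepS _ _ _ (gS z) _.
  exists (r - `|set_val (g z) - set_val (g (h y))|); first by rewrite subr_gt0.
  move=> w wz; rewrite bE hat_out ?of_real0 ?scale0r//.
  have := ler_distD (set_val w) (set_val (g (h y))) (set_val y).
  have := ler_distD (set_val (g z)) (set_val (g (h y))) (set_val w).
  rewrite [`|set_val (g z) - set_val w|]distrC [`|set_val (g (h y)) - set_val (g z)|]distrC.
  have -> : `|set_val (g (h y)) - set_val y| = 2 * r by rewrite mulrC divfK.
  by lra.
have := support_point_local sepT (hT y) Sb; rewrite SK bE hat_center of_real1 scale1r.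
by move/eqP; rewrite (negbTE Tf).
Qed.

Hypothesis gK : cancel g h.

(** Were [T f y] nonzero, [T f] would be nonzero around [y], in particular at some [g z] with [f]
    vanishing near [z = h (g z)]. *)
Lemma support_map_accumulation (f : ACspace X E) (y : Y) :
  (forall e : R, 0 < e -> exists2 z, `|set_val z - set_val (h y)| < e & vanishes_near f z) ->
  T f y = 0.
Proof.
move=> acc; apply/eqP/negPn/negP => /AC_neq0_near[d d0 hd].
have [e e0 he] := support_map_continuous sepS gS (h y) d0.
have [z /he + fz] := acc _ e0; rewrite support_mapK => /hd/eqP; apply.
by apply: support_point_local sepT _ _ _ (hT (g z)) _; rewrite gK.
Qed.

Lemma support_map_zero (f : ACspace X E) (y : Y) : f (h y) = 0 -> T f y = 0.
Proof.
move=> fh; have [|nf] := pselect (vanishes_near f (h y)).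
  exact: support_point_local sepT _ _ _ (hT y).
have [f1 [f2 [-> acc1 acc2]]] := AC_oscillation_split fh nf.
have [linT _] := sepT.
rewrite linear_addE// AC_addE !support_map_accumulation ?addr0//.
Qed.

End inverse_support_maps.

(** * Automatic continuity by gliding humps *)

Lemma seq_lower_bound (R : realType) (I : eqType) (w : I -> R) (s : seq I) :
  exists2 d : R, 0 < d & forall j, j \in s -> 0 < w j -> d <= w j.
Proof.
elim: s => [|i s [d d0 hd]]; first by exists 1.
have [wi|wi] := ltP 0 (w i); [exists (Num.min d (w i))|exists d] => //.
- by rewrite lt_min d0.
- move=> j; rewrite inE ge_min => /orP[/eqP->|/hd h /h->//]; by rewrite lexx orbT.
- by move=> j; rewrite inE => /orP[/eqP->|/hd//]; rewrite ltNge wi.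
Qed.

Section seq_variation_theory.
Context (R : realType) (k : scalar_kind) (X : set R) (E : normedModType (scalars R k)).
Implicit Types (f g : ACspace X E).

Lemma seq_variationD f g t s :
  seq_variation (f + g : ACspace X E) t s <= seq_variation f t s + seq_variation g t s.
Proof.
elim: s t => [|z s ih] t /=; first by rewrite addr0.
apply: le_trans (lerD _ (ih z)) _; last by rewrite addrACA.
by have := rnormD (f z - f t) (g z - g t); rewrite addrACA -opprD.
Qed.

Lemma seq_variationN f t s : seq_variation (- f : ACspace X E) t s = seq_variation f t s.
Proof.
elim: s t => //= z s ih t; rewrite ih; congr (_ + _).
by rewrite -[RHS]rnormN opprD.
Qed.

Lemma seq_variationZ (a : R) f t s :
  seq_variation (of_real k a *: f : ACspace X E) t s = `|a| * seq_variation f t s.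
Proof.
elim: s t => [|z s ih] t /=; first by rewrite mulr0.
by rewrite ih mulrDr -rnormZ scalerBr.
Qed.

Lemma seq_variation_sup f M t s :
  (forall x, rnorm (f x) <= M) -> seq_variation f t s <= (size s)%:R * (2 * M).
Proof.
move=> fM; elim: s t => [|z s ih] t /=; first by rewrite mul0r.
rewrite -natr1 mulrDl addrC mul1r lerD//.
by apply: le_trans (rnormD _ _) _; rewrite rnormN; have := fM z; have := fM t; lra.
Qed.

End seq_variation_theory.

Section weighted_composition.
Context (R : realType) (k : scalar_kind) (X Y : set R)
  (E : completeNormedModType (scalars R k)) (F : normedModType (scalars R k))
  (T : ACspace X E -> ACspace Y F) (h : Y -> X).
Hypothesis cptY : compact Y.
Hypothesis linT : linear T.
Hypothesis injh : injective h.
Hypothesis conth : forall y (e : R), 0 < e -> exists2 d : R, 0 < d &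
    forall y', `|set_val y' - set_val y| < d -> `|set_val (h y') - set_val (h y)| < e.
Hypothesis Th : forall (f : ACspace X E) y, f (h y) = 0 -> T f y = 0.

Lemma cofinite_fiber_bound : exists (B : seq Y) (C : R), forall y (f : ACspace X E),
  y \notin B -> rnorm (T f y) <= C * rnorm (f (h y)).
Proof.
apply: contrapT => nB.
have big (B : seq Y) (C : R) : exists (y : Y) (f : ACspace X E),
    y \notin B /\ C * rnorm (f (h y)) < rnorm (T f y).
  apply: contrapT => ny; apply: nB; exists B, C => y f yB.
  by rewrite leNgt; apply/negP => H; apply: ny; exists y, f.
(* A later hump dominated by [c y] vanishes at [h y], so its image is 0 at [y]. *)
pose c (y : Y) (x : X) : R := if x == h y then 0 else 1.
have [|||B M e e0|f hf] := @gliding_hump _ _ X E Y (fun=> True) (fun y f => rnorm (T f y)) c.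
- by move=> y f g; rewrite linear_addE// AC_addE rnormD.
- by move=> y f; rewrite linear_oppE// AC_oppE rnormN.
- move=> y u _ /(_ (h y)); rewrite /c eqxx => uh.
  rewrite Th ?rnorm0//; apply: rnorm_eq0; apply/le_anti.
  by rewrite uh rnorm_ge0.
- have [y [f [yB Hf]]] := big B (3 * M / e).
  set v := f (h y) in Hf.
  have v0 : 0 < rnorm v.
    rewrite rnorm_gt0; apply: contraTneq Hf => v0.
    by rewrite v0 (Th v0) !rnorm0 mulr0 ltxx.
  have [r r0 hr] := seq_lower_bound (fun j => `|set_val (h j) - set_val (h y)|) B.
  (* The bump has supremum [e / 3] and variation at most [2e / 3]; the factor [3 * M / e] above
     undoes this scaling. Its radius [r] keeps it away from the earlier [h j]. *)
  pose a := e / 3 / rnorm v.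
  have a0 : 0 < a by rewrite divr_gt0// divr_gt0.
  have [u [uh ur uv uvar]] := AC_bump (h y) (of_real k a *: v) r0.
  have av : rnorm (of_real k a *: v) = e / 3.
    by rewrite rnormZ gtr0_norm// divfK// gt_eqF.
  rewrite av in uv uvar.
  have Tu : T u y = of_real k a *: T f y.
    apply/eqP; rewrite -subr_eq0 -AC_scaleE -linear_scaleE// -AC_subE -linear_subE//.
    by apply/eqP/Th; rewrite AC_subE AC_scaleE uh subrr.
  exists y, u; split => //.
  + split=> //; rewrite Tu rnormZ gtr0_norm//.
    have : 3 * M / e * rnorm v * a < rnorm (T f y) * a by rewrite ltr_pM2r.
    have -> : 3 * M / e * rnorm v * a = M.
      by rewrite /a; field; rewrite !gt_eqF//.
    by rewrite mulrC => /ltW.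
  + by move=> x; apply: le_trans (uv x) _; lra.
  + by move=> t s /uvar; lra.
  + move=> j jB x; rewrite /c; case: eqP => [->|_]; last by rewrite mulr1; have := uv x; lra.
    rewrite ur ?rnorm0 ?mulr0//; apply: (hr _ jB).
    rewrite normr_gt0 subr_eq0 set_valE (inj_eq val_inj) (inj_eq injh).
    by apply: contraNneq yB => <-.
have [M hM] := AC_bounded cptY (T f).
by have [y _] := hf (M + 1); have := hM y; lra.
Qed.

(** Each [y] is a limit of points outside the finite set [B], and both sides of the bound are
    continuous in [y]. *)
Lemma fiber_bound :
  (forall (y : Y) (d : R), 0 < d -> exists2 y', y' != y & `|set_val y' - set_val y| < d) ->
  exists2 C : R, 0 <= C & forall y (f : ACspace X E), rnorm (T f y) <= C * rnorm (f (h y)).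
Proof.
move=> niso; have [B [C hC]] := cofinite_fiber_bound.
exists `|C| => // y f; apply/ler_addgt0Pr => e e0.
pose e' := e / (`|C| + 1).
have C1 : 0 < `|C| + 1 by rewrite ltr_wpDl.
have e'0 : 0 < e' by rewrite divr_gt0.
have [d1 d10 hd1] := AC_uniformly_continuous f e'0.
have [d2 d20 hd2] := AC_uniformly_continuous (T f) e'0.
have [d3 d30 hd3] := conth y d10.
have [d4 d40 hd4] := seq_lower_bound (fun j => `|set_val j - set_val y|) B.
have [|y' y'y] := niso y (Num.min d2 (Num.min d3 d4)); first by rewrite !lt_min d20 d30.
rewrite !lt_min => /and3P[/hd2 h2 /hd3/hd1 h1 h4].
have y'B : y' \notin B.
  apply/negP => /hd4; rewrite normr_gt0 subr_eq0 set_valE (inj_eq val_inj) y'y.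
  by move=> /(_ isT); rewrite leNgt -set_valE h4.
have a1 := rnorm_leD (T f y) (T f y'); rewrite rnormBC in a1.
have a2 := rnorm_leD (f (h y')) (f (h y)).
have a3 : C * rnorm (f (h y')) <= `|C| * (e' + rnorm (f (h y))).
  apply: le_trans (ler_wpM2r (rnorm_ge0 _) (ler_norm C)) _.
  by rewrite ler_wpM2l//; lra.
have a4 := hC y' f y'B.
have -> : e = `|C| * e' + e' by rewrite /e'; field; rewrite gt_eqF//.
by rewrite mulrDr in a3; lra.
Qed.

(** Along a fixed chain the variation of [T u] is at most [2 * C1 * size] times the supremum of [u];
    the weight [w] is chosen to make this at most 1. A failure of uniformity would then produce one
    [f] whose image has unbounded variation. *)
Lemma variation_bound (C1 : R) : 0 <= C1 ->
  (forall y (f : ACspace X E), rnorm (T f y) <= C1 * rnorm (f (h y))) ->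
  exists2 C : R, 0 <= C & forall f : ACspace X E,
    (forall x, rnorm (f x) <= 1) ->
    (forall t s, increasing_from t s -> seq_variation f t s <= 1) ->
    forall t s, increasing_from t s -> seq_variation (T f) t s <= C.
Proof.
move=> C10 TC1; apply: contrapT => nC.
have big (C : R) : exists f : ACspace X E, [/\ forall x, rnorm (f x) <= 1,
    forall t s, increasing_from t s -> seq_variation f t s <= 1 &
    exists t s, increasing_from t s /\ C < seq_variation (T f) t s].
  apply: contrapT => nf; apply: nC; exists `|C| => // f fs fv t s ts.
  rewrite leNgt; apply/negP => H; apply: nf; exists f; split => //.
  by exists t, s; split => //; apply: le_lt_trans H; rewrite ler_norm.
pose w (i : Y * seq Y) : R := (2 * C1 * (size i.2)%:R + 1)^-1.
have w0 i : 0 < w i by rewrite invr_gt0 ltr_wpDl// !mulr_ge0.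
have [|||I M e e0|f hf] := @gliding_hump _ _ X E (Y * seq Y)%type
    (fun i => increasing_from i.1 i.2) (fun i f => seq_variation (T f) i.1 i.2)
    (fun i _ => w i).
- move=> i f g; rewrite linear_addE//; exact: seq_variationD.
- move=> i f; rewrite linear_oppE//; exact: seq_variationN.
- move=> i u _ uw.
  have Tw y : rnorm (T u y) <= C1 * w i.
    by apply: le_trans (TC1 _ _) _; rewrite ler_wpM2l.
  apply: le_trans (seq_variation_sup _ _ Tw) _.
  have -> : (size i.2)%:R * (2 * (C1 * w i)) =
      (2 * C1 * (size i.2)%:R) / (2 * C1 * (size i.2)%:R + 1).
    by rewrite /w; ring.
  by rewrite ler_pdivrMr ?mul1r ?lerDl// ltr_wpDl// !mulr_ge0.
- have [d0 d00 hd0] := seq_lower_bound (fun j => e * w j) I.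
  (* Scaling by [d] puts the hump below [e] and below [e] times each earlier weight. *)
  pose d := Num.min d0 e; have d_gt0 : 0 < d by rewrite lt_min d00.
  have de : d <= e by rewrite ge_min lexx orbT.
  have [f [fs fv [t [s [ts Tts]]]]] := big (M / d).
  have us x : rnorm ((of_real k d *: f) x) <= d.
    by rewrite AC_scaleE rnormZ gtr0_norm// ler_piMr// ltW.
  exists (t, s), (of_real k d *: f); split.
  + split => //=; rewrite linear_scaleE// seq_variationZ gtr0_norm// mulrC.
    by rewrite -ler_pdivrMr// ltW.
  + by move=> x; apply: le_trans (us x) de.
  + move=> t' s' ts'; rewrite seq_variationZ gtr0_norm//; apply: le_trans _ de.
    by rewrite ler_piMr ?fv// ltW.
  + move=> j jI x; apply: le_trans (us x) _; apply: (@le_trans _ _ d0).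
      by rewrite ge_min lexx.
    by apply: hd0 => //; rewrite mulr_gt0.
have [V hV] := AC_bounded_variation cptY (T f).
by have [i /hV Vi] := hf (V + 1); lra.
Qed.

Lemma weighted_composition_continuous :
  (forall (y : Y) (d : R), 0 < d -> exists2 y', y' != y & `|set_val y' - set_val y| < d) ->
  ac_norm_continuous T.
Proof.
move=> /fiber_bound[C1 C10 TC1]; have [C2 C20 TC2] := variation_bound C10 TC1.
(* The two parts of the norm of the image are at most [C1 * d] and [C2 * d]; the [+ 1] gives a
   positive denominator and a strict inequality. *)
move=> f e e0; pose d := e / (C1 + C2 + 1).
have C0 : 0 < C1 + C2 + 1 by rewrite ltr_wpDl// addr_ge0.
have d0 : 0 < d by rewrite divr_gt0.
exists d => // g; rewrite -linear_subE//; set u := g - f => ud.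
have us : forall x, rnorm (u x) <= d.
  apply/sup_norm_le; first exact: ltW.
  by apply: le_trans (ltW ud); rewrite leeDl// variation_on_ge0.
have uv : forall t s, increasing_from t s -> seq_variation u t s <= d.
  apply/variation_on_le; first exact: ltW.
  by apply: le_trans (ltW ud); rewrite leeDr// sup_norm_ge0.
have Tus : (sup_norm (T u) <= (C1 * d)%:E)%E.
  apply/sup_norm_le; first by rewrite mulr_ge0// ltW.
  by move=> y; apply: le_trans (TC1 _ _) _; rewrite ler_wpM2l.
have Tuv : (variation_on (T u) <= (C2 * d)%:E)%E.
  apply/variation_on_le; first by rewrite mulr_ge0// ltW.
  have v1 x : rnorm ((of_real k d^-1 *: u : ACspace X E) x) <= 1.
    by rewrite AC_scaleE rnormZ gtr0_norm ?invr_gt0// ler_pdivrMl// mulr1.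
  have v2 t s : increasing_from t s ->
      seq_variation (of_real k d^-1 *: u : ACspace X E) t s <= 1.
    move=> /uv; rewrite seq_variationZ gtr0_norm ?invr_gt0//.
    by rewrite ler_pdivrMl// mulr1.
  move=> t s ts; have := TC2 _ v1 v2 t s ts.
  rewrite linear_scaleE// seq_variationZ gtr0_norm ?invr_gt0//.
  by rewrite ler_pdivrMl// mulrC.
apply: le_lt_trans (leeD Tus Tuv) _; rewrite -EFinD lte_fin.
rewrite -mulrDl /d mulrA ltr_pdivrMr// mulrC ltr_pM2l//.
by rewrite ltrDl.
Qed.

End weighted_composition.

(** * Topology of subsets of the line, and assembly of the theorem *)

Section subset_topology.
Context (R : realType).
Implicit Types (X Y : set R).

Lemma set_type_continuous X Y (h : Y -> X) :
  (forall y (e : R), 0 < e -> exists2 d : R, 0 < d &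
    forall y', `|set_val y' - set_val y| < d -> `|set_val (h y') - set_val (h y)| < e) ->
  continuous h.
Proof.
move=> hc y A /nbhs_ballP[e /= e0 eA]; have [d d0 hd] := hc y e e0.
apply/nbhs_ballP; exists d => // y' yy'; apply: eA; move: yy'.
by rewrite -!initial_ballE/= -!ball_normE/= distrC => /hd; rewrite distrC.
Qed.

Lemma not_isolated_near Y : isolated Y = set0 -> forall (y : Y) (d : R), 0 < d ->
  exists2 y', y' != y & `|set_val y' - set_val y| < d.
Proof.
move=> iso y d d0; apply: contrapT => ny.
suff : isolated Y (set_val y) by rewrite iso.
split; first by rewrite inE; exact: set_valP.
exists (ball (set_val y) d); first exact: nbhsx_ballx.
apply/seteqP; split=> [z [yz Yz]|_ ->]; last first.
  by split; [exact: ballxx|exact: set_valP].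
apply: contrapT => zy; apply: ny.
exists (exist _ z (mem_set Yz)).
  by apply/eqP => zE; apply: zy; rewrite -zE set_valE.
by move: yz; rewrite -ball_normE/= distrC set_valE.
Qed.

End subset_topology.

Lemma infinite_dimensional_nontrivial (K : fieldType) (E : lmodType K) :
  infinite_dimensional E -> exists v : E, v != 0.
Proof.
move=> infE; apply: contrapT => nv; apply: infE; exists 0%N, (fun=> 0) => v.
exists (fun=> 0); rewrite big_ord0; apply/eqP/negPn/negP => v0.
by apply: nv; exists v.
Qed.

Lemma biseparating_support_map (R : realType) (k : scalar_kind) (X Y : set R)
    (E F : normedModType (scalars R k)) (T : ACspace X E -> ACspace Y F)
    (S : ACspace Y F -> ACspace X E) :
  compact X -> (exists v : F, v != 0) -> cancel S T -> separating T ->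
  exists h : Y -> X, forall y, support_point T y (h y).
Proof.
move=> cptX [v v0] SK sepT; have [c cE] := AC_const Y v.
have hex y : exists x, support_point T y x.
  by apply: support_point_exists => //; exists (S c); rewrite SK cE.
by have [h hT] := choice hex; exists h.
Qed.

Theorem theorem4p8 (R : realType) (k : scalar_kind) (X Y : set R)
  (E F : completeNormedModType (scalars R k)) (T : ACspace X E -> ACspace Y F) :
  compact X -> compact Y ->
  infinite_dimensional E -> infinite_dimensional F ->
  biseparating T ->
  (exists (h : Y -> X) (J : Y -> E -> F),
    [/\ homeomorphism h,
        forall y, linear (J y) /\ bijective (J y) &
        forall (f : ACspace X E) (y : Y), T f y = J y (f (h y))]) /\
  (isolated Y = set0 -> ac_norm_continuous T).
Proof.
move=> cptX cptY /infinite_dimensional_nontrivial E0 /infinite_dimensional_nontrivial F0.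
move=> [S [TK SK sepT sepS]].
have [h hT] := biseparating_support_map cptX F0 SK sepT.
have [g gS] := biseparating_support_map cptY E0 TK sepS.
have hK : cancel h g := support_mapK cptY sepT sepS SK hT gS.
have gK : cancel g h := support_mapK cptX sepS sepT TK gS hT.
have Tz (f : ACspace X E) y : f (h y) = 0 -> T f y = 0.
  exact: (support_map_zero cptY sepT sepS SK hT gS gK).
have Sz (f : ACspace Y F) x : f (g x) = 0 -> S f x = 0.
  exact: (support_map_zero cptX sepS sepT TK gS hT hK).
have hc := support_map_continuous sepT hT; have gc := support_map_continuous sepS gS.
have linT : linear T by case: sepT.
split; last first.
  move=> /not_isolated_near; apply: weighted_composition_continuous hc Tz => //.
  exact: can_inj hK.
have [cst cstE] := choice (@AC_const R k X E).
(* The fibre map evaluates [T] on constants: [f] and the constant [f (h y)] agree at [h y], so their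
   images agree at [y]. *)
exists h, (fun y e => T (cst e) y).
have TJ (f : ACspace X E) y : T f y = T (cst (f (h y))) y.
  apply/eqP; rewrite -subr_eq0 -AC_subE -linear_subE//; apply/eqP/Tz.
  by rewrite AC_subE cstE subrr.
split => [|y|//].
  by exists g; split => //; exact: set_type_continuous.
split.
  move=> a u v; rewrite -AC_scaleE -AC_addE -linT; congr (T _ y).
  by apply: AC_ext => x; rewrite AC_addE AC_scaleE !cstE.
have [cst' cst'E] := choice (@AC_const R k Y F).
(* The inverse fibre map comes from [S] in the same way: [T (cst e)] agrees at [y = g (h y)] with a
   constant, so [S] gives both the same value at [h y]. *)
exists (fun v => S (cst' v) (h y)) => [e|v].
- have : S (cst' (T (cst e) y) - T (cst e)) (h y) = 0.
    by apply: Sz; rewrite hK AC_subE cst'E subrr.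
  have [linS _] := sepS.
  by rewrite linear_subE// AC_subE TK cstE => /eqP; rewrite subr_eq0 => /eqP.
- by rewrite -TJ SK cst'E.
Qed.
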